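(* Let $G$ be a finite quandle, $R$ a commutative ring, and $\phi:G\times G\to R^\times$ a quandle 2-cocycle. For an oriented virtual knot or link diagram $D$ and an automorphism $f$ of $G$, let $C(D,f)$ be the (finite) set of all possible colorings of $D$ with respect to $(G,f)$, and for a coloring let $\prod_{c}\phi(x_c,y_c)^{\sigma_c t}$ denote the product of its weights over all classical crossings $c$ of $D$ (with $t$ a formal parameter). 1. The function $$Z_3(D,\phi)=\sum_{f\in \mathrm{Aut}(G)}\ \prod_{A\in C(D,f)}\ \prod_{c}\phi(x_c,y_c)^{\sigma_c t},$$ where the sum is over all automorphisms $f$ of $G$, is invariant under all classical and virtual Reidemeister moves, i.e. it is an invariant of the oriented virtual knot or link represented by $D$. 2. For a fixed automorphism $f$ of $G$, the function $$Z_4(D,\phi,f)=\sum_{C_A}\Bigl(\prod_{B\in C_A}\ \prod_{c}\phi(x_c,y_c)^{\sigma_c t}\Bigr),$$ where the sum is over all equivalence classes $C_A$ of possible colorings in $C(D,f)$, the first product is over all colorings $B$ in the class $C_A$, and the second product is over all classical crossings $c$ of $D$ (weights taken in the coloring $B$), is invariant under all classical and virtual Reidemeister moves, i.e. it is an invariant of the oriented virtual knot or link represented by $D$. 3. If $\phi,\phi':G\times G\to R^\times$ are cohomologous 2-cocycles, then $Z_4(D,\phi,f)=Z_4(D,\phi',f)$ for every diagram $D$ and every automorphism $f$ of $G$.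
   Context: Quandle: a set $G$ with a binary operation $\ast$ such that (i) $a\ast a=a$ for all $a$; (ii) for all $a,b\in G$ there is a unique $x\in G$ with $x\ast a=b$; (iii) $(a\ast b)\ast c=(a\ast c)\ast(b\ast c)$ for all $a,b,c$. An automorphism of $G$ is a bijection $f:G\to G$ with $f(a\ast b)=f(a)\ast f(b)$. 2-cocycle: a map $\phi:G\times G\to R^\times$ (units of a commutative ring $R$) with $\phi(a,a)=1$ and $\phi(a,b)\,\phi(a\ast b,c)=\phi(a,c)\,\phi(a\ast c,b\ast c)$ for all $a,b,c\in G$. It is a coboundary if $\phi(x,y)=\psi(x)\psi(x\ast y)^{-1}$ for some map $\psi:G\to R^\times$. Two 2-cocycles $\phi,\phi'$ are cohomologous if $\phi=\delta\cdot\phi'$ (pointwise product) for some coboundary 2-cocycle $\delta$. Virtual diagrams: an oriented virtual link diagram $D$ is a generic immersion of finitely many oriented circles in the oriented plane, with each double point designated either a classical crossing (with over/under information) or a virtual crossing. Two diagrams represent the same oriented virtual link if they are related by planar isotopy and finitely many classical Reidemeister moves $\Omega_1,\Omega_2,\Omega_3$ and virtual moves, with all orientations allowed. The virtual moves are the analogues of $\Omega_1,\Omega_2,\Omega_3$ in which all crossings are virtual (the first three virtual moves), and the mixed move $\Omega_3'$, in which a strand having two virtual crossings with the two strands of a classical crossing is moved across that classical crossing. Arcs: an arc of $D$ is a maximal piece of a component which contains no under-passage of a classical crossing and no virtual crossing in its interior (it may pass over classical crossings; a component with no under-passages and no virtual crossings is a single arc). Possible coloring with respect to $(G,f)$: an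 assignment of an element of $G$ to each arc such that: (a) at each classical crossing, if the over-arc has color $y$ and the under-arc lying to the right of the oriented over-arc has color $x$, then the under-arc lying to the left of the over-arc has color $x\ast y$; (b) at each virtual crossing, the strand that crosses the other one from its left to its right (with respect to the orientation of the other strand) changes color from $a$ (incoming) to $f(a)$ (outgoing), and the strand that crosses the other one from its right to its left changes color from $b$ (incoming) to $f^{-1}(b)$ (outgoing). Equivalence of colorings: for a possible coloring $A$, let $f(A)$ be the coloring obtained by applying $f$ to the color of every arc (again a possible coloring). Two possible colorings $A_1,A_2$ are equivalent if $A_2=f^k(A_1)$ for some $k\in\mathbb{N}$; $C_A$ denotes the equivalence class of $A$. (This is an equivalence relation since $G$ is finite.) Weights: for a coloring and a classical crossing $c$, let $y_c$ be the color of the over-arc, $x_c$ the color of the under-arc on the right of the over-arc, and $\sigma_c\in\{1,-1\}$ the sign of the crossing (positive when the under-strand passes from right to left of the over-strand). The weight of $c$ is $\phi(x_c,y_c)^{\sigma_c t}$; virtual crossings have weight $1$. Formal parameter: for $u\in R^\times$, $u^{t}$ is a formal symbol subject to $u^tv^t=(uv)^t$, $u^{-t}=(u^{-1})^t$, $1^t=1$; that is, products of weights are regarded as elements of the group $R^\times$ and sums of such products as elements of the group ring $\mathbb{Z}[R^\times]$, with $u^t$ the basis element of $u$. *)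

(* Defs.v *)
From HB Require Import structures.
From mathcomp Require Import all_boot all_order all_fingroup all_algebra.
From mathcomp Require Import finmap monalg.
From mathcomp Require Import all_classical all_reals all_analysis.
From Stdlib Require Import Relation_Operators.

Set Implicit Arguments.
Unset Strict Implicit.
Unset Printing Implicit Defensive.

Import Order.TTheory GRing.Theory Num.Theory.
Import numFieldNormedType.Exports.

Local Open Scope classical_set_scope.
Local Open Scope ring_scope.

Section Quandles.
Variables (G : Type) (op : G -> G -> G).

Definition quandle : Prop :=
  [/\ forall a, op a a = a,
      forall a b, exists! x, op x a = b
    & forall a b c, op (op a b) c = op (op a c) (op b c)].

End Quandles.

Definition quandle_aut (G : finType) (op : G -> G -> G) (f : {perm G}) : bool :=
  [forall a, forall b, f (op a b) == op (f a) (f b)].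

Section Units.
Variable K : comUnitRingType.

Record units := Units { uval :> K; uvalP : uval \is a GRing.unit }.

HB.instance Definition _ := [isSub for uval].
HB.instance Definition _ := [Choice of units by <:].

Fact umul_subproof (u v : units) : uval u * uval v \is a GRing.unit.
Proof. by rewrite unitrM !uvalP. Qed.

Fact uinv_subproof (u : units) : (uval u)^-1 \is a GRing.unit.
Proof. by rewrite unitrV uvalP. Qed.

Definition uone : units := Units (unitr1 K).
Definition umul (u v : units) : units := Units (umul_subproof u v).
Definition uinv (u : units) : units := Units (uinv_subproof u).

Fact umulA : associative umul.
Proof. by move=> u v w; apply: val_inj; rewrite /= mulrA. Qed.

Fact umulC : commutative umul.
Proof. by move=> u v; apply: val_inj; rewrite /= mulrC. Qed.

Fact umul1u : left_id uone umul.
Proof. by move=> u; apply: val_inj; rewrite /= mul1r. Qed.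

HB.instance Definition _ :=
  Monoid.isComLaw.Build units uone umul umulA umulC umul1u.

End Units.

Notation "\uprod_ ( i '\in' A ) F" :=
  (\big[@umul _/@uone _]_(i \in A) F)
  (at level 36, F at level 36, A at level 60, i at level 50,
   format "'[' \uprod_ ( i  '\in'  A ) '/  '  F ']'").

(* Elements of the group ring Z[K^x], as finitely supported integer
   functions on K^x; the formal power u^t is the basis element
   of u, so that u^t v^t = (uv)^t, and products of weights are taken in K^x. *)
Definition formal_power (K : comUnitRingType) (u : units K) :
  {malg int[units K]} := << u >>.

Section Cocycles.
Variables (K : comUnitRingType) (G : Type) (op : G -> G -> G).

Definition cocycle (phi : G -> G -> units K) : Prop :=
  (forall a, phi a a = uone K) /\
  (forall a b c, umul (phi a b) (phi (op a b) c)
               = umul (phi a c) (phi (op a c) (op b c))).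

Definition coboundary (delta : G -> G -> units K) : Prop :=
  exists psi : G -> units K,
    forall x y, delta x y = umul (psi x) (uinv (psi (op x y))).

Definition cohomologous (phi phi' : G -> G -> units K) : Prop :=
  exists delta, [/\ cocycle delta, coboundary delta
    & forall x y, phi x y = umul (delta x y) (phi' x y)].

End Cocycles.

(* Each circle is R/Z, and a closed curve is a 1-periodic function on R.  [mark]
   says how a component passes at each parameter: [Simple] away from the double
   points, [Over]/[Under] at a classical crossing, [Virtual] at a virtual one. *)
Inductive passage := Simple | Over | Under | Virtual.

Section Plane.
Variable R : realType.

Definition plane := (R * R)%type.

(* Positive iff v points to the left of u in the oriented plane. *)
Definition cross (u v : plane) : R := u.1 * v.2 - u.2 * v.1.

Definition same_point n (p q : 'I_n * R) : Prop :=
  p.1 = q.1 /\ exists m : int, q.2 = p.2 + m%:~R.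

Definition double n (gam : 'I_n -> R -> plane) (p q : 'I_n * R) : Prop :=
  ~ same_point p q /\ gam p.1 p.2 = gam q.1 q.2.

Record diagram (n : nat) := Diagram {
  curve : 'I_n -> R -> plane;
  mark : 'I_n -> R -> passage;
  curve_periodic : forall i t, curve i (t + 1) = curve i t;
  curve_derivable : forall i t, derivable (curve i) t 1;
  curve_C1 : forall i, continuous (derive1 (curve i));
  curve_immersed : forall i t, derive1 (curve i) t != 0;
  double_finite : finite_set
    [set p | 0 <= p.2 < 1 /\ exists q, double curve p q];
  double_only : forall p q r,
    double curve p q -> double curve p r -> same_point q r;
  double_transversal : forall p q, double curve p q ->
    cross (derive1 (curve p.1) p.2) (derive1 (curve q.1) q.2) != 0;
  mark_periodic : forall i t, mark i (t + 1) = mark i t;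
  mark_simple : forall p,
    ~ (exists q, double curve p q) -> mark p.1 p.2 = Simple;
  mark_double : forall p q, double curve p q ->
    [\/ mark p.1 p.2 = Over /\ mark q.1 q.2 = Under,
        mark p.1 p.2 = Under /\ mark q.1 q.2 = Over
      | mark p.1 p.2 = Virtual /\ mark q.1 q.2 = Virtual]
}.

Definition velocity n (D : diagram n) (p : 'I_n * R) : plane :=
  derive1 (curve D p.1) p.2.

(* At the double point with preimages p and q, the strand through p crosses
   the strand through q from its right to its left. *)
Definition from_right n (D : diagram n) (p q : 'I_n * R) : bool :=
  0 < cross (velocity D q) (velocity D p).

(* Under-passages and virtual crossings: the end points of the arcs. *)
Definition arc_end n (D : diagram n) (i : 'I_n) (t : R) : Prop :=
  mark D i t = Under \/ mark D i t = Virtual.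

(* One pair (under-passage, over-passage) for each classical crossing. *)
Definition classical_crossings n (D : diagram n) :
    set (('I_n * R) * ('I_n * R)) :=
  [set c | [/\ 0 <= c.1.2 < 1, 0 <= c.2.2 < 1, double (curve D) c.1 c.2,
                mark D c.1.1 c.1.2 = Under & mark D c.2.1 c.2.2 = Over]].

Section Moves.
Variable n : nat.
Implicit Types D : diagram n.

(* Defined for all times s for convenience; the isotopy runs from s = 0 to 1. *)
Definition ambient_isotopy (H : R -> plane -> plane) : Prop :=
  [/\ forall p, H 0 p = p,
      forall s, bijective (H s),
      continuous (fun z : R * plane => H z.1 z.2),
      forall s p, differentiable (H s) p
    & (forall v : plane, continuous (fun z : R * plane => 'D_v (H z.1) z.2)) /\
      (forall s p, cross ('D_((1, 0) : plane) (H s) p)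
                         ('D_((0, 1) : plane) (H s) p) != 0)].

(* An orientation preserving change of parameter of R/Z. *)
Definition reparametrization (r : R -> R) : Prop :=
  [/\ forall t, r (t + 1) = r t + 1,
      forall t, derivable r t 1,
      continuous (derive1 r)
    & forall t, 0 < derive1 r t].

Definition planar_isotopic D D' : Prop :=
  exists (H : R -> plane -> plane) (sigma : {perm 'I_n}) (r : 'I_n -> R -> R),
  [/\ ambient_isotopy H,
      forall i, reparametrization (r i),
      forall i t, curve D' (sigma i) (r i t) = H 1 (curve D i t)
    & forall i t, mark D' (sigma i) (r i t) = mark D i t].

(* The part of D in the closed unit disc consists of m disjoint strands: the
   j-th one is the restriction of component k j to the interval [a j, b j].
   Up to planar isotopy (which includes moving the base points of the circles),
   every closed disc meeting D in m proper strands is of this form. *)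
Definition strands m (k : 'I_m -> 'I_n) (a b : 'I_m -> R) D : Prop :=
  [/\ forall j, [/\ 0 < a j, a j < b j & b j < 1],
      forall j l, j != l -> k j = k l -> b j < a l \/ b l < a j
    & forall i t, 0 <= t < 1 ->
        ((curve D i t).1 ^+ 2 + (curve D i t).2 ^+ 2 <= 1 <->
         exists j, i = k j /\ a j <= t <= b j)].

Definition agree_outside m (k : 'I_m -> 'I_n) (a b : 'I_m -> R) D D' : Prop :=
  forall i t, 0 <= t < 1 -> ~ (exists j, i = k j /\ a j <= t <= b j) ->
    curve D i t = curve D' i t /\ mark D i t = mark D' i t.

(* In each move D and D' agree outside the unit disc.  The strands of a move
   may belong to the same component. *)
Definition local_change m (k : 'I_m -> 'I_n) (a b : 'I_m -> R) D D' : Prop :=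
  [/\ strands k a b D, strands k a b D' & agree_outside k a b D D'].

(* Omega_1 and its virtual analogue: one strand gets a single self-crossing
   (of any kind and sign). *)
Definition move1 D D' : Prop :=
  exists (k : 'I_1 -> 'I_n) (a b : 'I_1 -> R) (s t : R),
  [/\ local_change k a b D D',
      forall x, a 0 <= x <= b 0 -> mark D (k 0) x = Simple,
      [/\ a 0 < s, s < t & t < b 0],
      curve D' (k 0) s = curve D' (k 0) t
    & forall x, a 0 <= x <= b 0 -> x <> s -> x <> t ->
        mark D' (k 0) x = Simple].

(* Omega_2 and its virtual analogue: two disjoint strands become strands
   crossing exactly twice, the second time in the opposite direction; strand 0
   is over at both crossings, under at both, or both are virtual. *)
Definition move2 D D' : Prop :=
  exists (k : 'I_2 -> 'I_n) (a b : 'I_2 -> R) (s t s' t' : R),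
  [/\ local_change k a b D D',
      forall j x, a j <= x <= b j -> mark D (k j) x = Simple,
      [/\ a 0 < s < b 0, a 0 < s' < b 0, a 1 < t < b 1, a 1 < t' < b 1
        & s != s' /\ t != t'],
      [/\ curve D' (k 0) s = curve D' (k 1) t,
          curve D' (k 0) s' = curve D' (k 1) t',
          from_right D' (k 0, s) (k 1, t) != from_right D' (k 0, s') (k 1, t')
        & mark D' (k 0) s = mark D' (k 0) s']
    & (forall x, a 0 <= x <= b 0 -> x <> s -> x <> s' ->
         mark D' (k 0) x = Simple) /\
      (forall x, a 1 <= x <= b 1 -> x <> t -> x <> t' ->
         mark D' (k 1) x = Simple)].

(* Three strands, any two of which cross exactly once: u j l is the parameter
   on strand j of its crossing with strand l. *)
Definition triangle (k : 'I_3 -> 'I_n) (a b : 'I_3 -> R)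
    (u : 'I_3 -> 'I_3 -> R) D : Prop :=
  (forall j l, j != l ->
     a j < u j l < b j /\ curve D (k j) (u j l) = curve D (k l) (u l j)) /\
  (forall j x, a j <= x <= b j -> (forall l, j != l -> x <> u j l) ->
     mark D (k j) x = Simple).

(* Omega_3, its virtual analogue and the mixed move Omega_3'.  Before the move
   the three strands are segments forming a triangle (as can be achieved by a
   planar isotopy); after it, each strand meets the other two in the opposite
   order, and the crossings keep their kind and sign. *)
Definition move3 D D' : Prop :=
  exists (k : 'I_3 -> 'I_n) (a b : 'I_3 -> R) (u u' : 'I_3 -> 'I_3 -> R),
  [/\ [/\ local_change k a b D D', triangle k a b u D & triangle k a b u' D'],
      exists P V : 'I_3 -> plane, forall j x, a j <= x <= b j ->
        curve D (k j) x = P j + x *: V j,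
      let type := (mark D (k 0) (u 0 1), mark D (k 0) (u 0 2),
                   mark D (k 1) (u 1 2)) in
      [\/ type = (Over, Over, Over), type = (Virtual, Virtual, Virtual)
        | type = (Virtual, Virtual, Over)],
      forall j l, j != l ->
        mark D' (k j) (u' j l) = mark D (k j) (u j l) /\
        from_right D' (k j, u' j l) (k l, u' l j)
          = from_right D (k j, u j l) (k l, u l j)
    & forall j l m, j != l -> j != m -> l != m ->
        (u j l < u j m) = (u' j m < u' j l)].

Definition same_link : diagram n -> diagram n -> Prop :=
  clos_refl_sym_trans _ (fun D D' =>
    [\/ planar_isotopic D D', move1 D D', move2 D D' | move3 D D']).

End Moves.

Section Invariants.
Variables (G : finType) (op : G -> G -> G) (n : nat).
Implicit Types (D : diagram n) (f : {perm G}).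

(* A coloring is recorded by the pair A i t of the colors of component i just
   before and just after the parameter t. *)
Definition colors := 'I_n -> R -> G * G.
Implicit Type A : colors.

Definition before A (p : 'I_n * R) : G := (A p.1 p.2).1.
Definition after A (p : 'I_n * R) : G := (A p.1 p.2).2.

(* The colors of the strand through p on either side of the one through q. *)
Definition right_color D A (p q : 'I_n * R) : G :=
  if from_right D p q then before A p else after A p.
Definition left_color D A (p q : 'I_n * R) : G :=
  if from_right D p q then after A p else before A p.

(* The first three clauses say that A is induced by a map from the arcs to G. *)
Definition coloring D f A : Prop :=
  [/\ forall i t, A i (t + 1) = A i t,
      forall i t, ~ arc_end D i t -> before A (i, t) = after A (i, t),
      forall i s t, s < t -> (forall x, s < x < t -> ~ arc_end D i x) ->
        after A (i, s) = before A (i, t),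
      forall p q, double (curve D) p q ->
        mark D p.1 p.2 = Under -> mark D q.1 q.2 = Over ->
        left_color D A p q = op (right_color D A p q) (after A q)
    & forall p q, double (curve D) p q -> mark D p.1 p.2 = Virtual ->
        after A p = if from_right D p q then (f^-1)%g (before A p)
                    else f (before A p)].

Definition colorings D f : set colors := [set A | coloring D f A].

Definition map_colors f A : colors :=
  fun i t => (f (A i t).1, f (A i t).2).

Definition coloring_class f A : set colors :=
  [set B | exists k : nat, B = iter k (map_colors f) A].

Definition coloring_classes D f : set (set colors) :=
  [set C | exists2 A, A \in colorings D f & C = coloring_class f A].

Variables (K : comUnitRingType) (phi : G -> G -> units K).

Definition crossing_weight D A (c : ('I_n * R) * ('I_n * R)) : units K :=
  let w := phi (right_color D A c.1 c.2) (after A c.2) in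
  if from_right D c.1 c.2 then w else uinv w.

Definition weight D A : units K :=
  \uprod_(c \in classical_crossings D) crossing_weight D A c.

Definition Z3 D : {malg int[units K]} :=
  \sum_(f : {perm G} | quandle_aut op f)
    formal_power (\uprod_(A \in colorings D f) weight D A).

Definition Z4 D f : {malg int[units K]} :=
  \sum_(C \in coloring_classes D f)
    formal_power (\uprod_(B \in C) weight D B).

End Invariants.
End Plane.

(* Main.v *)
(* Passing a double point changes a color by [passed]: the quandle acts at an
   under-passage, f or its inverse at a virtual crossing.  Colorings are the step
   functions along the circles that satisfy this rule at the double points, and
   each move gives a bijection between the colorings of the two diagrams that
   commutes with f.

   For the classical moves the weights of corresponding colorings agree, by the
   quandle axioms and the cocycle identity.  In the mixed move the moved strand
   applies f or its inverse to the two colors at the classical crossing, so the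
   weight of A changes by a factor w(f A) / w(A), which cancels in the product
   over an orbit of f, hence in Z4, and in the product over all colorings, hence
   in Z3.  Replacing phi by a cohomologous cocycle changes the weight by a factor
   of the same form: the product of psi(before) / psi(after) over all passages of
   a circle telescopes to 1, so the product over the under-passages is the
   inverse of the product over the virtual ones, where colors change by f. *)

Require Import Defs.
From mathcomp Require Import all_boot all_order all_fingroup all_algebra.
From mathcomp Require Import monalg.
From mathcomp Require Import all_classical all_reals all_analysis.
From mathcomp Require Import zify ring lra.
From Stdlib Require Import Relation_Operators.

Set Implicit Arguments.
Unset Strict Implicit.
Unset Printing Implicit Defensive.

Import Order.TTheory GRing.Theory Num.Theory.
Import numFieldNormedType.Exports.

Local Open Scope classical_set_scope.
Local Open Scope ring_scope.

(** A move allows any order of its crossings along the strands, any orientations, and strands on a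
    common circle. To avoid the resulting cases, the disc is treated as a black box: the colors [x]
    entering the strands force the coloring inside ([local_solution]). A move then reduces to two
    facts about functions of [x]: both diagrams have the same outgoing colors, and their local
    weights differ by a factor [v (f x) / v x]. Colors on a strand with two crossings are functions
    of two booleans, one for each crossing already passed, so no order is ever chosen.

    In the triangle, orders and directions are not independent: strands 1 and 2 meet on one side of
    strand 0. This relation is read off the straight segments and survives reversing all orders at
    fixed signs, which is how it reaches the diagram after the move, where the strands need not be
    straight. *)

Local Notation double := Defs.double.

(** * The group of units of a commutative ring *)

Section UnitGroup.
Variable K : comUnitRingType.
Implicit Types u v w : units K.

Lemma umulu1 u : umul u (uone K) = u.
Proof. by rewrite umulC umul1u. Qed.

Lemma umuluV u : umul u (uinv u) = uone K.
Proof. by apply: val_inj; rewrite /= divrr // uvalP. Qed.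

Lemma umulVu u : umul (uinv u) u = uone K.
Proof. by rewrite umulC umuluV. Qed.

Lemma umulVKu u v : umul (uinv u) (umul u v) = v.
Proof. by rewrite umulA umulVu umul1u. Qed.

Lemma umulIu w : injective (fun u => umul u w).
Proof.
move=> u v e; rewrite -(umulu1 u) -(umulu1 v) -(umuluV w) !umulA.
by rewrite e.
Qed.

Lemma uinvK u : uinv (uinv u) = u.
Proof. by apply: val_inj; rewrite /= invrK. Qed.

Lemma uinvM u v : uinv (umul u v) = umul (uinv u) (uinv v).
Proof. by apply: val_inj; rewrite /= invrM ?uvalP // mulrC. Qed.

Lemma uinv1 : uinv (uone K) = uone K.
Proof. by apply: val_inj; rewrite /= invr1. Qed.

Lemma umulCA u v w : umul u (umul v w) = umul v (umul u w).
Proof. by rewrite umulA (umulC u) -umulA. Qed.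

Lemma umulAC u v w : umul (umul u v) w = umul (umul u w) v.
Proof. by rewrite -umulA (umulC v) umulA. Qed.

End UnitGroup.

(** * Products over stable sets and sums over orbits *)

Section OrbitProducts.
Variables (K : comUnitRingType) (T : choiceType) (g : T -> T) (N : nat).
Hypotheses (N_gt0 : (0 < N)%N) (gN : forall x, iter N g x = x).
Variables (S S' : set T).
Hypotheses (finS : finite_set S) (gS : forall x, S x -> S (g x)).
Variables (h : T -> T) (W W' v : T -> units K).
Hypotheses (h_bij : set_bij S S' h) (hg : forall x, S x -> h (g x) = g (h x)).
Hypothesis hW : forall x, S x -> umul (W' (h x)) (v x) = umul (W x) (v (g x)).

Definition orbit_of (x : T) : set T := [set y | exists k, y = iter k g x].

Let g_inj : injective g.
Proof.
apply: (@can_inj _ _ _ (iter N.-1 g)) => x.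
by rewrite -iterSr prednK // gN.
Qed.

Let iter_stable (A : set T) : (forall x, A x -> A (g x)) ->
  forall k x, A x -> A (iter k g x).
Proof. by move=> gA; elim=> //= k IH x /IH /gA. Qed.

Lemma set_bij_stable (A : set T) :
  (forall x, A x -> A (g x)) -> set_bij A A g.
Proof.
move=> gA; split=> [x /gA //|x y _ _ /g_inj //|y Ay].
exists (iter N.-1 g y); first exact: iter_stable.
by rewrite -iterS prednK // gN.
Qed.

Lemma finite_orbit x : finite_set (orbit_of x).
Proof.
apply: (sub_finite_set _ (finite_image (fun k => iter k g x) (finite_II N))).
move=> y [k ->]; exists (k %% N)%N; first by rewrite /= ltn_mod.
rewrite {2}(divn_eq k N) addnC iterD; congr (iter _ g _).
by elim: (k %/ N)%N => // m IH; rewrite mulSn iterD -IH gN.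
Qed.

(** Since [g] permutes [A], the factors [v x] and [v (g x)] have the same product over [A], which
    cancels. The set [A] is all of [S] in one application and a single orbit in the other. *)
Lemma uprod_transfer (A : set T) : finite_set A -> A `<=` S ->
  (forall x, A x -> A (g x)) ->
  \uprod_(x \in A) W' (h x) = \uprod_(x \in A) W x.
Proof.
move=> finA AS gA; apply: (@umulIu _ (\uprod_(x \in A) v x)).
rewrite -fsbig_split // [X in _ = umul _ X](reindex_fsbig g A A v) //; last first.
  exact: set_bij_stable.
rewrite -fsbig_split //.
by apply: eq_fsbigr => x; rewrite inE => /AS; apply: hW.
Qed.

Lemma uprod_transfer_all : \uprod_(y \in S') W' y = \uprod_(x \in S) W x.
Proof. by rewrite (reindex_fsbig _ _ _ _ h_bij) uprod_transfer. Qed.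

Definition orbits_of (A : set T) : set (set T) :=
  [set C | exists2 x, x \in A & C = orbit_of x].

Lemma orbit_sub (A : set T) x : (forall x, A x -> A (g x)) -> A x ->
  orbit_of x `<=` A.
Proof. by move=> gA Ax y [k ->]; apply: iter_stable. Qed.

Lemma orbit_stable x y : orbit_of x y -> orbit_of x (g y).
Proof. by move=> [k ->]; exists k.+1. Qed.

Lemma image_orbit x : S x -> h @` orbit_of x = orbit_of (h x).
Proof.
move=> Sx; have hk k : h (iter k g x) = iter k g (h x).
  by elim: k => //= k <-; rewrite hg //; apply: iter_stable.
apply/seteqP; split=> [_ [_ [k ->] <-]|_ [k ->]]; first by exists k.
by exists (iter k g x) => //; exists k.
Qed.

(** Commuting with [g], the bijection [h] carries orbits onto orbits and so induces a bijection
    between the two index sets; the summands agree by the product formula on each orbit. *)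
Lemma sum_orbits_transfer :
  \sum_(C \in orbits_of S') formal_power (\uprod_(y \in C) W' y) =
  \sum_(C \in orbits_of S) formal_power (\uprod_(x \in C) W x).
Proof.
have [hS hinj hsurj] := h_bij.
have hb : set_bij (orbits_of S) (orbits_of S') (fun C => h @` C).
  split.
  - move=> C [x]; rewrite inE => Sx ->; exists (h x); last exact: image_orbit.
    by rewrite inE; apply: hS.
  - move=> C1 C2; rewrite !inE => -[x1]; rewrite inE => Sx1 ->.
    move=> [x2]; rewrite inE => Sx2 -> /seteqP [s1 s2].
    have o1 := orbit_sub gS Sx1; have o2 := orbit_sub gS Sx2.
    apply/seteqP; split=> y yo.
      have [z zo] := s1 _ (ex_intro2 _ _ y yo erefl).
      by move=> /hinj <- //; rewrite inE; [apply: o2|apply: o1].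
    have [z zo] := s2 _ (ex_intro2 _ _ y yo erefl).
    by move=> /hinj <- //; rewrite inE; [apply: o1|apply: o2].
  - move=> C [y]; rewrite inE => S'y ->; have [x Sx <-] := hsurj _ S'y.
    exists (orbit_of x); last exact: image_orbit.
    by exists x; rewrite ?inE.
rewrite (reindex_fsbig _ _ _ _ hb); apply: eq_fsbigr => C.
rewrite inE => -[x]; rewrite inE => Sx ->.
rewrite fsbig_image; last first.
  by move=> y z; rewrite !inE => /(orbit_sub gS Sx) ? /(orbit_sub gS Sx) ?;
     apply: hinj; rewrite inE.
by rewrite uprod_transfer //;
  [apply: finite_orbit|apply: orbit_sub|apply: orbit_stable].
Qed.

End OrbitProducts.

(** * The actions of crossings on colors, and signed cocycle weights *)

Definition vact (G : finType) (f : {perm G}) (e : bool) (x : G) : G :=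
  if e then (f^-1)%g x else f x.

Section QuandleAction.
Variables (G : finType) (op : G -> G -> G) (Gquandle : quandle op).

(** The inverse of right translation by [y]; in a quandle the default [x] is never reached. *)
Definition unop (x y : G) : G := odflt x [pick z | op z y == x].

(* The color of an under-strand after passing under an over-strand of color y;
   e tells whether it passes from the right to the left. *)
Definition act (e : bool) (x y : G) : G := if e then op x y else unop x y.

Lemma opK x y : unop (op x y) y = x.
Proof.
have [_ uni _] := Gquandle; rewrite /unop; case: pickP => [z /eqP zy|/(_ x)].
  by have [w [_ wu]] := uni y (op x y); rewrite -(wu z) // (wu x).
by rewrite eqxx.
Qed.

Lemma unopK x y : op (unop x y) y = x.
Proof. by have [_ /(_ y x) [z [<- _]] _] := Gquandle; rewrite opK. Qed.

Lemma op_inj y : injective (op^~ y).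
Proof. by apply: (@can_inj _ _ _ (unop^~ y)) => x; rewrite opK. Qed.

Lemma opxx x : op x x = x.
Proof. by have [/(_ x)] := Gquandle. Qed.

Lemma op_distr x y z : op (op x y) z = op (op x z) (op y z).
Proof. by have [_ _ /(_ x y z)] := Gquandle. Qed.

Lemma actK e x y : act (~~ e) (act e x y) y = x.
Proof. by case: e; rewrite /act /= ?opK ?unopK. Qed.

Lemma actNK e x y : act e (act (~~ e) x y) y = x.
Proof. by case: e; rewrite /act /= ?opK ?unopK. Qed.

Lemma actxx e x : act e x x = x.
Proof. by case: e; rewrite /act ?opxx // -{1}(opxx x) opK. Qed.

Lemma act_aut (f : G -> G) : (forall x y, f (op x y) = op (f x) (f y)) ->
  forall e x y, f (act e x y) = act e (f x) (f y).
Proof.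
move=> fM [] x y; rewrite /act // -[in RHS](unopK x y) fM opK //.
Qed.

(** Right translation by [z] is a homomorphism by self-distributivity, hence commutes with [act e'];
    for the inverse translation the identity is pulled back by injectivity. *)
Lemma act_distr e e' x y z :
  act e (act e' x y) z = act e' (act e x z) (act e y z).
Proof.
have H b u v : op (act b u v) z = act b (op u z) (op v z).
  by apply: (@act_aut (op^~ z)) => ? ?; exact: op_distr.
case: e; rewrite /(act _ _ z) ?H //.
by apply: (@op_inj z); rewrite H !unopK.
Qed.

Lemma vact_act (f : {perm G}) : quandle_aut op f ->
  forall e e' x y, vact f e (act e' x y) = act e' (vact f e x) (vact f e y).
Proof.
move=> /forallP fop e; have fM x y : f (op x y) = op (f x) (f y).
  by have /forallP/(_ y)/eqP := fop x.
case: e => e' x y; rewrite /vact; last exact: act_aut.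
apply: (@act_aut (f^-1)%g) => {}x {}y; apply: (@perm_inj _ f).
by rewrite fM !permKV.
Qed.

Lemma vactK (f : {perm G}) e x : vact f (~~ e) (vact f e x) = x.
Proof. by case: e; rewrite /vact /= ?permK ?permKV. Qed.

Lemma vactNK (f : {perm G}) e x : vact f e (vact f (~~ e) x) = x.
Proof. by case: e; rewrite /vact /= ?permK ?permKV. Qed.

Lemma vactC (f : {perm G}) e e' x :
  vact f e (vact f e' x) = vact f e' (vact f e x).
Proof. by case: e e' => [] [] //; rewrite /vact ?permK ?permKV. Qed.

Variables (K : comUnitRingType) (phi : G -> G -> units K).
Hypothesis phi_cocycle : cocycle op phi.

(** The weight in terms of the color [x] entering the under-strand: if this strand passes from left
    to right, the color on the right is the outgoing one, [unop x y]. *)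
Definition wt (e : bool) (x y : G) : units K :=
  if e then phi x y else uinv (phi (unop x y) y).

Lemma wtxx e x : wt e x x = uone K.
Proof.
have [phi1 _] := phi_cocycle.
have /= := actxx false x; rewrite /wt /act => ->.
by rewrite phi1 uinv1; case: e.
Qed.

Lemma wtN e x y : umul (wt e x y) (wt (~~ e) (act e x y) y) = uone K.
Proof. by case: e; rewrite /wt /act /= ?opK ?umuluV ?umulVu. Qed.

(** Every choice of directions is an instance of the cocycle identity, taken at images under [unop]
    where a direction is reversed, with factors moved across. The two sides are the weights met by
    the lowest strand of a triangle in its two orders. *)
Lemma wt_cocycle e e' x y z :
  umul (wt e x y) (wt e' (act e x y) z) =
  umul (wt e' x z) (wt e (act e' x z) (act e' y z)).
Proof.
have [_ phiM] := phi_cocycle.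
have H (a b c d : units K) : umul a b = umul c d ->
    umul d (uinv b) = umul (uinv c) a.
  move=> abcd; apply: (@umulIu _ b).
  by rewrite -umulA umulVu umulu1 -umulA abcd umulVKu.
case: e e' => [] []; rewrite /wt /act /=.
- exact: phiM.
- have := phiM (unop x z) (unop y z) z; rewrite !unopK => /H.
  have -> : unop (op x y) z = op (unop x z) (unop y z).
    by apply: (@op_inj z); rewrite op_distr !unopK.
  by [].
- have := phiM (unop x y) y z; rewrite !unopK => phiE.
  have -> : unop (op x z) (op y z) = op (unop x y) z.
    by apply: (@op_inj (op y z)); rewrite unopK -op_distr unopK.
  exact/esym/H/esym.
- have phiE := phiM (unop (unop x y) z) (unop y z) z; rewrite !unopK in phiE.
  have xE : unop x z = op (unop (unop x y) z) (unop y z).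
    by apply: (@op_inj z); rewrite op_distr !unopK.
  by rewrite xE opK -!uinvM [in RHS]umulC phiE umulC.
Qed.

End QuandleAction.

(** * Step functions on the real line *)

Section StepFunctions.
Variables (R : realType) (C : Type).
Implicit Types (g : R -> C * C) (s t x y : R).

(* g t records the values of a step function just before and just after t. *)
Definition stepwise g : Prop := forall t, \forall x \near t,
  (t < x -> g x = ((g t).2, (g t).2)) /\ (x < t -> g x = ((g t).1, (g t).1)).

Lemma near_eps (t : R) (P : R -> Prop) : (\forall x \near t, P x) <->
  exists2 e, 0 < e & forall x, t - e < x < t + e -> P x.
Proof.
split=> [/nbhs_ballP[e /= e0 eP]|[e e0 eP]].
  exists e => // x xe; apply: eP; rewrite /ball /= ltr_norml; lra.
apply/nbhs_ballP; exists e => // x; rewrite /ball /= ltr_norml => xe.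
by apply: eP; lra.
Qed.

Lemma stepwise_cst (c : C) : stepwise (fun=> (c, c)).
Proof. by move=> t; apply/near_eps; exists 1. Qed.

Lemma near_le (p t : R) : \forall x \near t,
  (t < x -> (p < x) = (p <= t) /\ (p <= x) = (p <= t)) /\
  (x < t -> (p < x) = (p < t) /\ (p <= x) = (p < t)).
Proof.
apply/near_eps; have [->|pt] := eqVneq p t.
  exists 1 => // x _; split=> xt.
    by rewrite xt lexx (ltW xt).
  by rewrite ltxx; split; apply/negbTE; rewrite -?leNgt -?ltNge // ltW.
exists `|p - t|; first by rewrite normr_gt0 subr_eq0.
move=> x; have [tp|pt'] := ltP t p.
  rewrite gtr0_norm ?subr_gt0 // => xe.
  have F y : y < p -> (p < y) = false /\ (p <= y) = false.
    by move=> yp; rewrite leNgt yp ltNge ltW.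
  have [tF tF'] := F t tp; have [-> ->] := F x ltac:(lra).
  by rewrite ?tF ?tF'.
have {}pt' : p < t by rewrite lt_neqAle pt.
rewrite ltr0_norm ?subr_lt0 // => xe.
have px : p < x by lra.
by rewrite ?pt' px !ltW.
Qed.

(* h b b' is the value after passing p iff b and after passing q iff b'; this
   covers both orders of p and q. *)
Definition two_steps (p q : R) (h : bool -> bool -> C) (x : R) : C * C :=
  (h (p < x) (q < x), h (p <= x) (q <= x)).

Lemma two_steps_stepwise p q h : stepwise (two_steps p q h).
Proof.
move=> t; near=> x.
have [[pr pl] [qr ql]] : ((t < x -> (p < x) = (p <= t) /\ (p <= x) = (p <= t)) /\
  (x < t -> (p < x) = (p < t) /\ (p <= x) = (p < t))) /\
  ((t < x -> (q < x) = (q <= t) /\ (q <= x) = (q <= t)) /\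
  (x < t -> (q < x) = (q < t) /\ (q <= x) = (q < t))).
  by split; near: x; apply: near_le.
rewrite /two_steps /=; split=> xt.
  by have [-> ->] := pr xt; have [-> ->] := qr xt.
by have [-> ->] := pl xt; have [-> ->] := ql xt.
Unshelve. all: by end_near. Qed.

(** A supremum argument: agreement reaches the supremum because both functions are constant just
    before it, crosses it by the jump hypothesis, and continues because both are constant just after
    it. *)
Lemma stepwise_unique g1 g2 a b : stepwise g1 -> stepwise g2 ->
  (g1 a).1 = (g2 a).1 ->
  (forall x, a <= x <= b -> (g1 x).1 = (g2 x).1 -> (g1 x).2 = (g2 x).2) ->
  forall x, a <= x <= b -> g1 x = g2 x.
Proof.
move=> sg1 sg2 g12a step x0 ax0.
have g12P x : a <= x <= b -> (g1 x).1 = (g2 x).1 -> g1 x = g2 x.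
  move=> xab g12; rewrite (surjective_pairing (g1 x)) (step _ xab g12) g12.
  by case: (g2 x).
have ab : a <= b by lra.
pose E := [set x | a <= x <= b /\ forall y, a <= y <= x -> g1 y = g2 y].
have Ea : E a.
  split=> [|y ya]; first by rewrite lexx.
  by have -> : y = a; [lra|apply: g12P; rewrite ?lexx].
have ubE : has_ubound E by exists b => x [] /andP[].
have supE : has_sup E by split; first by exists a.
set s := sup E.
have as_ : a <= s by apply: ub_le_sup.
have sb : s <= b by apply: ge_sup; [exists a|move=> x [] /andP[]].
have below y : a <= y < s -> g1 y = g2 y.
  move=> ys; have [z Ez zy] := @sup_adherent _ E (s - y) ltac:(lra) supE.
  rewrite -/s in zy; have [_] := Ez; apply; lra.
have gs : g1 s = g2 s.
  apply: g12P; first by rewrite as_.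
  have [sa|as'] := leP s a; first by have -> : s = a by lra.
  have /near_eps[e1 e1_gt0 H1] := sg1 s.
  have /near_eps[e2 e2_gt0 H2] := sg2 s.
  pose e := Num.min (Num.min e1 e2) (s - a).
  have e0 : 0 < e by rewrite !lt_min e1_gt0 e2_gt0 subr_gt0.
  have [ee1 [ee2 ee3]] : e <= e1 /\ e <= e2 /\ e <= s - a.
    by rewrite /e !ge_min !lexx !orbT.
  have yr : s - e < s - e / 2 < s by lra.
  have := below (s - e / 2) ltac:(lra).
  have [_ ->] := H1 (s - e / 2) ltac:(lra); last by lra.
  by have [_ ->] := H2 (s - e / 2) ltac:(lra); [case|lra].
have Es y : a <= y <= s -> g1 y = g2 y.
  move=> ys; have [ys'|sy] := ltP y s; first by apply: below; lra.
  by have -> : y = s by lra.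
suff sb' : s = b by apply: Es; rewrite sb'.
apply/eqP; rewrite eq_le sb leNgt; apply/negP => sb'.
have /near_eps[e1 e1_gt0 H1] := sg1 s.
have /near_eps[e2 e2_gt0 H2] := sg2 s.
pose e := Num.min (Num.min e1 e2) (b - s).
have e0 : 0 < e by rewrite !lt_min e1_gt0 e2_gt0 subr_gt0.
have [ee1 [ee2 ee3]] : e <= e1 /\ e <= e2 /\ e <= b - s.
  by rewrite /e !ge_min !lexx !orbT.
have : E (s + e / 2).
  split=> [|y ye]; first by lra.
  have [ys|sy] := leP y s; first by apply: Es; lra.
  have [-> //] := H1 y ltac:(lra).
  by have [-> //] := H2 y ltac:(lra); rewrite gs.
move=> /(ub_le_sup ubE); rewrite -/s; lra.
Qed.

Lemma stepwise_const g s t : stepwise g -> s < t ->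
  (forall x, s < x < t -> (g x).1 = (g x).2) -> (g s).2 = (g t).1.
Proof.
move=> sg st gst.
have /near_eps[e1 e1_gt0 H1] := sg s.
have /near_eps[e2 e2_gt0 H2] := sg t.
pose e := Num.min (Num.min e1 e2) (t - s).
have e0 : 0 < e by rewrite !lt_min e1_gt0 e2_gt0 subr_gt0.
have [ee1 [ee2 ee3]] : e <= e1 /\ e <= e2 /\ e <= t - s.
  by rewrite /e !ge_min !lexx !orbT.
(* As [e <= t - s], shrinking by [e / 3] at both ends leaves a nonempty interval whose ends lie
   where [g] still has its value after [s] and already has its value before [t]. *)
have [gs _] := H1 (s + e / 3) ltac:(lra).
have [_ gt] := H2 (t - e / 3) ltac:(lra).
have := @stepwise_unique g (fun=> ((g s).2, (g s).2)) (s + e / 3) (t - e / 3)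
  sg (@stepwise_cst _).
rewrite gs /=; last by lra.
move=> /(_ erefl) H.
have /H : forall x, s + e / 3 <= x <= t - e / 3 ->
    (g x).1 = (g s).2 -> (g x).2 = (g s).2.
  by move=> x xst <-; rewrite gst //; lra.
move=> /(_ (t - e / 3) ltac:(lra)); rewrite gt; last by lra.
by case.
Qed.

(** Between consecutive points of [F] the function is constant, so the denominator at one point
    cancels the numerator at the next. *)
Lemma stepwise_telescope (K : comUnitRingType) (psi : C -> units K) g s t F :
  stepwise g -> path <%R s F -> all (< t) F -> s < t ->
  (forall x, s < x < t -> x \notin F -> (g x).1 = (g x).2) ->
  \big[@umul K/uone K]_(x <- F) umul (psi (g x).1) (uinv (psi (g x).2)) =
  umul (psi (g s).2) (uinv (psi (g t).1)).
Proof.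
move=> sg; elim: F s => [|y F IH] s /=.
  move=> _ _ st gst; rewrite big_nil (stepwise_const sg st) ?umuluV //.
  by move=> x /gst; apply.
move=> /andP[sy yF] /andP[yt Ft] st gst.
have ltF x : x \in F -> y < x.
  by move: yF; rewrite lt_path_sortedE => /andP[/allP H _] /H.
rewrite big_cons (IH y) //; last first.
  move=> x yx xF; apply: gst; first by lra.
  by rewrite inE negb_or xF andbT gt_eqF //; case/andP: yx.
rewrite (stepwise_const sg sy) -?umulA ?umulVKu // => x xsy.
apply: gst; first by lra.
rewrite inE negb_or lt_eqF; last by lra.
by apply/negP => /ltF; lra.
Qed.

End StepFunctions.

(** * Fractional parts and neighborhoods on the circle *)

Section FractionalPart.
Variable R : realType.
Implicit Types (t x : R) (m : int).

Definition frac x : R := x - (Num.floor x)%:~R.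

Lemma frac_itv x : 0 <= frac x < 1.
Proof. by rewrite /frac subr_ge0 floor_le_tmp ltrBlDl -intrD1 floorD1_gt. Qed.

Lemma fracE x m : 0 <= x - m%:~R < 1 -> frac x = x - m%:~R.
Proof.
move=> xm; rewrite /frac; congr (_ - _%:~R); apply: floor_def.
by rewrite intrD; lra.
Qed.

Lemma frac_id x : 0 <= x < 1 -> frac x = x.
Proof. by move=> x01; rewrite (@fracE x 0) subr0. Qed.

Lemma frac_frac x : frac (frac x) = frac x.
Proof. exact/frac_id/frac_itv. Qed.

Lemma fracD x m : frac (x + m%:~R) = frac x.
Proof.
rewrite (@fracE _ (Num.floor x + m)) intrD; first by rewrite /frac; lra.
by have := frac_itv x; rewrite /frac; lra.
Qed.

Lemma frac_shift x : exists m, x = frac x + m%:~R.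
Proof. by exists (Num.floor x); rewrite /frac subrK. Qed.

Lemma near_frac x : 0 < frac x ->
  \forall y \near x, frac y = y - (Num.floor x)%:~R.
Proof.
move=> x0; have := frac_itv x; rewrite /frac in x0 *; set m := (_)%:~R => xm.
apply/near_eps; exists (Num.min (x - m) (1 - (x - m))).
  by rewrite lt_min; lra.
move=> y yx; apply: fracE; rewrite -/m; move: yx.
have : Num.min (x - m) (1 - (x - m)) <= x - m by rewrite ge_min lexx.
have : Num.min (x - m) (1 - (x - m)) <= 1 - (x - m) by rewrite ge_min lexx orbT.
lra.
Qed.

(** A closed arc avoiding the base point is closed in the circle. Near an integer the fractional
    part is close to 0 or to 1, whence the radius given by [a] and [1 - b]. *)
Lemma near_frac_out x a b : 0 < a -> a < b -> b < 1 -> ~~ (a <= frac x <= b) ->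
  \forall y \near x, ~~ (a <= frac y <= b).
Proof.
move=> a0 ab b1 xab; have := frac_itv x; set u := frac x in xab * => u01.
have xE : x = u + (Num.floor x)%:~R by rewrite /u /frac subrK.
set m := (Num.floor x) in xE.
have [u0|u0] := eqVneq u 0.
  apply/near_eps; exists (Num.min a (1 - b)); first by rewrite lt_min; lra.
  have : Num.min a (1 - b) <= a by rewrite ge_min lexx.
  have : Num.min a (1 - b) <= 1 - b by rewrite ge_min lexx orbT.
  move=> H1 H2 y yx; have [ym|ym] := leP m%:~R y.
    rewrite (@fracE y m); first by apply/negP; lra.
    by lra.
  have m1 : (m - 1)%:~R = m%:~R - 1 :> R by rewrite intrB.
  rewrite (@fracE y (m - 1)) m1; first by apply/negP; lra.
  by lra.
have /near_frac : 0 < frac x by rewrite -/u lt_neqAle eq_sym u0; case/andP: u01.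
rewrite -/m => /near_eps[e e0 He].
have [ua|bu] : u < a \/ b < u.
  by case/nandP: xab => H; [left|right]; rewrite ltNge.
- apply/near_eps; exists (Num.min e (a - u)); first by rewrite lt_min; lra.
  have : Num.min e (a - u) <= e by rewrite ge_min lexx.
  have : Num.min e (a - u) <= a - u by rewrite ge_min lexx orbT.
  by move=> H1 H2 y yx; rewrite He; [apply/negP; lra|lra].
- apply/near_eps; exists (Num.min e (u - b)); first by rewrite lt_min; lra.
  have : Num.min e (u - b) <= e by rewrite ge_min lexx.
  have : Num.min e (u - b) <= u - b by rewrite ge_min lexx orbT.
  by move=> H1 H2 y yx; rewrite He; [apply/negP; lra|lra].
Qed.

Lemma periodic_int (T : Type) (g : R -> T) :
  (forall t, g (t + 1) = g t) -> forall t m, g (t + m%:~R) = g t.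
Proof.
move=> g1 t; have gn n : forall t, g (t + n%:R) = g t.
  by elim: n => [|n IH] u; rewrite ?addr0 // -natr1 addrA g1.
by case=> n; rewrite ?NegzE ?rmorphN /= ?gn // -[in RHS](subrK n.+1%:R t) gn.
Qed.

End FractionalPart.

Lemma int_gap (R : realType) (m : int) :
  [\/ m%:~R = 0 :> R, m%:~R <= -1 :> R | 1 <= m%:~R :> R].
Proof.
have [m0|m0|->] := ltrgtP m 0; last by constructor 1.
  constructor 2; rewrite -(intrN R 1) ler_int; lia.
constructor 3; rewrite (ler_int R 1); lia.
Qed.

(** * Periodicity and double points of a diagram *)

Section DiagramBasics.
Variables (R : realType) (n : nat) (D : diagram R n).
Implicit Types (p q : 'I_n * R) (i j : 'I_n) (t : R) (m : int).

Definition norm_pt p : 'I_n * R := (p.1, frac p.2).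

Lemma curve_int i t m : curve D i (t + m%:~R) = curve D i t.
Proof. exact: (periodic_int (@curve_periodic _ _ D i)). Qed.

Lemma mark_int i t m : mark D i (t + m%:~R) = mark D i t.
Proof. exact: (periodic_int (@mark_periodic _ _ D i)). Qed.

Lemma velocity_int i t m : velocity D (i, t + m%:~R) = velocity D (i, t).
Proof.
rewrite /velocity /= /derive1.
suff -> : (fun h => h^-1 *: (curve D i (h + (t + m%:~R)) -
    curve D i (t + m%:~R))) =
  (fun h => h^-1 *: (curve D i (h + t) - curve D i t)) by [].
by apply/funext => h; rewrite addrA !curve_int.
Qed.

Lemma curve_frac i t : curve D i (frac t) = curve D i t.
Proof. by have [m {2}->] := frac_shift t; rewrite curve_int. Qed.

Lemma mark_frac i t : mark D i (frac t) = mark D i t.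
Proof. by have [m {2}->] := frac_shift t; rewrite mark_int. Qed.

Lemma velocity_norm p : velocity D (norm_pt p) = velocity D p.
Proof.
case: p => i t; rewrite /norm_pt /=.
by have [m {2}->] := frac_shift t; rewrite velocity_int.
Qed.

Lemma from_right_norm p q :
  from_right D (norm_pt p) (norm_pt q) = from_right D p q.
Proof. by rewrite /from_right !velocity_norm. Qed.

Lemma same_point_norm p q : same_point p q <-> norm_pt p = norm_pt q.
Proof.
case: p q => i s [j t]; rewrite /same_point /norm_pt /=; split.
  by move=> [-> [m ->]]; rewrite fracD.
move=> [-> st]; split=> //.
have [m ->] := frac_shift t; have [m' ->] := frac_shift s.
by exists (m - m'); rewrite st intrB addrA addrAC addrK.
Qed.

Lemma double_norm p q :
  double (curve D) (norm_pt p) (norm_pt q) <-> double (curve D) p q.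
Proof.
by rewrite /double !same_point_norm /norm_pt /= !frac_frac !curve_frac.
Qed.

Lemma double_sym p q : double (curve D) p q -> double (curve D) q p.
Proof. by rewrite /double !same_point_norm => -[/nesym]. Qed.

Lemma norm_pt_id p : 0 <= p.2 < 1 -> norm_pt p = p.
Proof. by case: p => i t /= t01; rewrite /norm_pt /= frac_id. Qed.

Lemma cross_anti (u v : plane R) : cross u v = - cross v u.
Proof. rewrite /cross; lra. Qed.

Lemma from_rightN p q : double (curve D) p q ->
  from_right D q p = ~~ from_right D p q.
Proof.
move=> /double_transversal; rewrite /from_right /velocity => c0.
by rewrite [in RHS]cross_anti oppr_gt0 -leNgt lt_def c0.
Qed.

Lemma nonsimple_double p : mark D p.1 p.2 <> Simple ->
  exists q, double (curve D) p q.
Proof. by move=> mp; apply: contrapT => /(mark_simple (d := D)). Qed.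

Lemma double_nonsimple p q : double (curve D) p q -> mark D p.1 p.2 <> Simple.
Proof. by move=> /mark_double[] [-> _]. Qed.

Definition nonsimple : set ('I_n * R) :=
  [set p | 0 <= p.2 < 1 /\ mark D p.1 p.2 <> Simple].

Lemma finite_nonsimple : finite_set nonsimple.
Proof.
apply: sub_finite_set (double_finite D) => p [p01 /nonsimple_double[q pq]].
by split=> //; exists q.
Qed.

Lemma finite_classical_crossings : finite_set (classical_crossings D).
Proof.
apply: sub_finite_set (finite_setX finite_nonsimple finite_nonsimple).
by move=> [p q] [/= p01 q01 pq mp mq]; split; split=> //=; rewrite ?mp ?mq.
Qed.

(** Nonsimple points are isolated, being finitely many in each period. *)
Lemma near_simple i t : \forall x \near t, x != t -> mark D i x = Simple.
Proof.
have H u : \forall x \near t, x != t -> frac x != u.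
  have [m tE] := frac_shift t.
  (* [e] is a lower bound for the distance from [t] to the other points of [u + Z]: 1 if [t] is
     itself such a point, otherwise the smaller of [|d|] and [1 - |d|]. *)
  pose d := u - frac t; pose e := if d == 0 then 1 else Num.min `|d| (1 - `|d|).
  have [|ule] := boolP (0 <= u < 1); last first.
    apply/near_eps; exists 1 => // x _ _; apply: contraNN ule => /eqP <-.
    exact: frac_itv.
  have := frac_itv t => t01 u01.
  have d1 : `|d| < 1 by rewrite ltr_norml /d; lra.
  have e0 : 0 < e.
    by rewrite /e; case: eqVneq => // dn0; rewrite lt_min normr_gt0 dn0; lra.
  apply/near_eps; exists e => // x xt; apply: contraNN => /eqP xu.
  have [k xE] := frac_shift x.
  have xtE : x - t = d + (k - m)%:~R by rewrite xE {1}tE intrB /d -xu; lra.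
  suff [d0 km] : d = 0 /\ k = m.
    by rewrite -subr_eq0 xtE km subrr d0 addr0.
  have : `|d + (k - m)%:~R| < e by rewrite -xtE ltr_norml; lra.
  rewrite /e; have := int_gap R (k - m).
  case: eqVneq => [->|dn0 kmP].
    rewrite add0r ltr_norml => -[] km0 km1.
    - by split=> //; apply/eqP; rewrite -subr_eq0 -(intr_eq0 R) km0 eqxx.
    - by exfalso; lra.
    - by exfalso; lra.
  rewrite lt_min => /andP[]; case: kmP => kmP; first by rewrite kmP addr0 ltxx.
    move: d1; have [d0|d0] := ltP d 0.
      by rewrite (ltr0_norm d0) !ltr_norml => d1 /andP[H1 H2] H3; exfalso; lra.
    by rewrite (ger0_norm d0) !ltr_norml => d1 /andP[H1 H2] H3; exfalso; lra.
  move: d1; have [d0|d0] := ltP d 0.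
    by rewrite (ltr0_norm d0) !ltr_norml => d1 /andP[H1 H2] H3; exfalso; lra.
  by rewrite (ger0_norm d0) !ltr_norml => d1 /andP[H1 H2] H3; exfalso; lra.
have /finite_seqP[s sE] := finite_nonsimple.
have {}H : \forall x \near t, x != t -> frac x \notin [seq p.2 | p <- s].
  elim: [seq p.2 | p <- s] => [|u r IH]; first by apply/near_eps; exists 1.
  near=> x => xt; rewrite inE negb_or; apply/andP; split.
    by move: xt; near: x; apply: H.
  by move: xt; near: x.
near=> x => xt; apply: contrapT => mx.
have : frac x \notin [seq p.2 | p <- s] by move: xt; near: x.
case/mapP; exists (i, frac x) => //.
have : nonsimple (i, frac x) by split=> /=; rewrite ?frac_itv ?mark_frac.
by rewrite sE.
Unshelve. all: by end_near. Qed.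

End DiagramBasics.

(** * Colorings as step functions *)

Section ColoringRules.
Variables (R : realType) (G : finType) (op : G -> G -> G) (n : nat).
Hypothesis Gquandle : quandle op.
Variables (f : {perm G}).
Implicit Types (D : diagram R n) (A B : colors R G n).

(* The color after a passage, from the color x before it and the color z of the
   other strand. *)
Definition passed (mk : passage) (e : bool) (x z : G) : G :=
  match mk with
  | Simple | Over => x
  | Under => act op e x z
  | Virtual => vact f e x
  end.

Lemma left_right_act e x x' z :
  ((if e then x' else x) = op (if e then x else x') z) <-> x' = act op e x z.
Proof.
by case: e; split=> //= [->|->]; rewrite /act /= ?(opK Gquandle) ?(unopK Gquandle).
Qed.

(** The arc conditions become local. As nonsimple points are isolated, constancy along arcs means
    being a step function without jumps at simple points, and the relation between left and right
    colors is solved for the outgoing color. *)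
Lemma coloringP D A : coloring op D f A <->
  [/\ forall i t, A i (t + 1) = A i t,
      forall i, stepwise (A i),
      forall i t, mark D i t = Simple -> (A i t).1 = (A i t).2
    & forall p q, double (curve D) p q ->
        after A p = passed (mark D p.1 p.2) (from_right D p q)
                      (before A p) (after A q)].
Proof.
split=> [[A1 Aeq Aconst Aclass Avirt]|[A1 Astep Aeq Adouble]].
  have simpleE i t : mark D i t = Simple -> ~ arc_end D i t.
    by move=> m0 []; rewrite m0.
  split=> //.
  - move=> i t; have /near_eps[e e0 He] := near_simple D i t.
    apply/near_eps; exists e => // x xe; split=> xt.
      have xS : A i x = (before A (i, x), after A (i, x)).
        exact: surjective_pairing.
      have nx : ~ arc_end D i x by apply/simpleE/He; [|rewrite gt_eqF].
      rewrite xS -Aeq // -(Aconst i t x) // => y ty.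
      by apply/simpleE/He; [lra|rewrite gt_eqF //; lra].
    have xS : A i x = (before A (i, x), after A (i, x)).
      exact: surjective_pairing.
    have nx : ~ arc_end D i x by apply/simpleE/He; [|rewrite lt_eqF].
    rewrite xS Aeq // (Aconst i x t) // => y ty.
    by apply/simpleE/He; [lra|rewrite lt_eqF //; lra].
  - by move=> i t m0; apply: Aeq; apply: simpleE.
  - move=> [i s] [j t] pq; have /= := mark_double pq.
    move=> [] [mp mq]; rewrite /= mp /=.
    + by symmetry; apply: Aeq => -[]; rewrite mp.
    + by have /left_right_act := Aclass _ _ pq mp mq.
    + exact: Avirt.
have endE i t : ~ arc_end D i t -> (A i t).1 = (A i t).2.
  move=> nt; have [m0|] := pselect (mark D i t = Simple); first exact: Aeq.
  move=> /(@nonsimple_double _ _ _ (i, t))[q pq].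
  have := Adouble _ _ pq; have /= := mark_double pq.
  move=> [] [mp mq]; rewrite /= mp //=; case: nt; by [left|right].
split=> //.
- by move=> i s t st nost; apply: stepwise_const => // x /nost /endE.
- move=> p q pq mp mq; apply/left_right_act.
  by have := Adouble _ _ pq; rewrite mp.
- move=> p q pq mp; by have := Adouble _ _ pq; rewrite mp.
Qed.

Lemma coloring_int D A : coloring op D f A ->
  forall i t (m : int), A i (t + m%:~R) = A i t.
Proof. by move=> [A1 _ _ _ _] i; apply: periodic_int. Qed.

Lemma coloring_frac D A : coloring op D f A ->
  forall i t, A i (frac t) = A i t.
Proof.
move=> cA i t; have [m {2}->] := frac_shift t; by rewrite (coloring_int cA).
Qed.

Lemma coloring_unique D A B : coloring op D f A -> coloring op D f B ->
  (forall i, A i 0 = B i 0) -> (forall p, nonsimple D p -> A p.1 p.2 = B p.1 p.2) ->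
  A = B.
Proof.
move=> cA cB AB0 ABn; have /coloringP[_ As Aeq _] := cA.
have /coloringP[_ Bs Beq _] := cB.
apply/funext => i; apply/funext => t.
rewrite -(coloring_frac cA) -(coloring_frac cB).
have := frac_itv t; move: (frac t) => {}t t01.
apply: (@stepwise_unique _ _ _ _ 0 t) => //; rewrite ?AB0 ?lexx ?andbT //.
  move=> x xt; have [m0|mx] := pselect (mark D i x = Simple).
    by rewrite -Aeq // -Beq.
  by rewrite (ABn (i, x)) //; split=> //=; lra.
by case/andP: t01.
Qed.

Lemma finite_colorings D : finite_set (colorings op D f).
Proof.
have /finite_seqP[s sE] := finite_nonsimple D.
(* A coloring is determined by its values at the base points and at the nonsimple points, a tuple
   over the finite set [G * G]. *)
pose pts := [seq (i, 0) | i <- enum 'I_n] ++ s.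
pose values A := map_tuple (fun p => A p.1 p.2) (in_tuple pts).
have inj A B : coloring op D f A -> coloring op D f B ->
    values A = values B -> A = B.
  move=> cA cB /(congr1 val) /= /eq_in_map AB.
  apply: coloring_unique cA cB _ _ => [i|p].
    apply: (AB (i, 0)); rewrite mem_cat; apply/orP; left.
    by apply: map_f; rewrite mem_enum.
  by rewrite sE => /= ps; apply: AB; rewrite mem_cat ps orbT.
have [->|/set0P[A0 cA0]] := eqVneq (colorings op D f) set0.
  exact: finite_set0.
pose sol v := xget A0 [set A | coloring op D f A /\ values A = v].
apply: (@sub_finite_set _ _ (sol @` setT)).
  move=> A cA; exists (values A) => //.
  rewrite /sol; case: xgetP => [B _ [cB /inj]|/(_ A)/not_andP[]//].
  exact.
exact/finite_image/finite_finset.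
Qed.

Lemma coloring_map D A : quandle_aut op f -> coloring op D f A ->
  coloring op D f (map_colors f A).
Proof.
move=> f_aut /coloringP[A1 Astep Aeq Adouble]; apply/coloringP; split.
- by move=> i t; rewrite /map_colors A1.
- move=> i t; have /near_eps[e e0 He] := Astep i t.
  apply/near_eps; exists e => // x /He; rewrite /map_colors => -[xr xl].
  by split=> [/xr|/xl] ->.
- by move=> i t /Aeq; rewrite /map_colors /= => ->.
move=> p q pq; rewrite /after /before /map_colors /=.
have := Adouble _ _ pq; rewrite /after /before => ->.
case: (mark D p.1 p.2) => //=; first exact: (vact_act Gquandle f_aut false).
exact: (vactC f false).
Qed.

Lemma iter_map_colors A k :
  iter k (map_colors f) A = fun i t => (iter k f (A i t).1, iter k f (A i t).2).
Proof.
elim: k => [|k IH] /=; last by rewrite IH.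
by apply/funext => i; apply/funext => t; rewrite -surjective_pairing.
Qed.

Lemma map_colors_order A : iter #[f]%g (map_colors f) A = A.
Proof.
rewrite iter_map_colors; apply/funext => i; apply/funext => t.
by rewrite -!permX expg_order !perm1 -surjective_pairing.
Qed.

Variables (K : comUnitRingType) (phi : G -> G -> units K).

Lemma crossing_weightE D A c : coloring op D f A -> classical_crossings D c ->
  crossing_weight phi D A c =
  wt op phi (from_right D c.1 c.2) (before A c.1) (after A c.2).
Proof.
move=> /coloringP[_ _ _ Adouble] [_ _ pq mp mq].
rewrite /crossing_weight /wt /right_color.
have := Adouble _ _ pq; rewrite mp /= => ->.
by case: (from_right D c.1 c.2).
Qed.

End ColoringRules.

(** * From a relation between colorings to equality of the invariants *)

Section Transfer.
Variables (R : realType) (G : finType) (op : G -> G -> G) (n : nat).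
Hypothesis Gquandle : quandle op.
Variables (K : comUnitRingType) (phi phi' : G -> G -> units K).
Variables (D D' : diagram R n).

(* The factor v, a coboundary for the action of f on colorings, cancels in the
   product over an orbit of f. *)
Definition related_by (f : {perm G}) (rel : colors R G n -> colors R G n -> Prop)
    (v : colors R G n -> units K) : Prop :=
  [/\ forall A, coloring op D f A -> exists2 A', coloring op D' f A' & rel A A',
      forall A', coloring op D' f A' -> exists2 A, coloring op D f A & rel A A',
      forall A B A' B', coloring op D f A -> coloring op D f B ->
        coloring op D' f A' -> coloring op D' f B' ->
        rel A A' -> rel B B' -> A = B <-> A' = B',
      forall A A', rel A A' -> rel (map_colors f A) (map_colors f A')
    & forall A A', coloring op D f A -> coloring op D' f A' -> rel A A' ->
        umul (weight phi' D' A') (v A) = umul (weight phi D A) (v (map_colors f A))].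

(** Choice turns [rel] into a bijection [h] between the two sets of colorings that commutes with
    [map_colors f]; iterating the latter as often as the order of [f] gives the identity, so the
    results on orbits apply. *)
Lemma related_transfer f rel v : quandle_aut op f -> related_by f rel v ->
  \uprod_(A \in colorings op D' f) weight phi' D' A =
    \uprod_(A \in colorings op D f) weight phi D A /\
  Z4 op phi' D' f = Z4 op phi D f.
Proof.
move=> f_aut [rtot rsurj rbij rmap rweight].
pose h A := xget A [set A' | coloring op D' f A' /\ rel A A'].
have hP A : coloring op D f A -> coloring op D' f (h A) /\ rel A (h A).
  move=> /rtot[A' cA' AA']; rewrite /h; case: xgetP => [B _ //|/(_ A')].
  by move=> /not_andP[].
have h_bij : set_bij (colorings op D f) (colorings op D' f) h.
  split=> [A /hP[]//|A B|A' cA'].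
    rewrite !inE => cA cB AB; have [cA' AA'] := hP _ cA; have [cB' BB'] := hP _ cB.
    by apply/(rbij A B (h A) (h B)).
  have [A cA AA'] := rsurj _ cA'; exists A => //; have [cA2 AA2] := hP _ cA.
  exact/(rbij A A (h A) A').
have h_map A : colorings op D f A ->
    h (map_colors f A) = map_colors f (h A).
  move=> cA; have [cA' AA'] := hP _ cA.
  have cfA := coloring_map Gquandle f_aut cA.
  have cfA' := coloring_map Gquandle f_aut cA'.
  have [? ?] := hP _ cfA.
  by apply/(rbij (map_colors f A) (map_colors f A)) => //; apply: rmap.
have hw A : colorings op D f A ->
    umul (weight phi' D' (h A)) (v A) =
    umul (weight phi D A) (v (map_colors f A)).
  by move=> cA; have [? ?] := hP _ cA; apply: rweight.
have cS A : colorings op D f A -> colorings op D f (map_colors f A).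
  exact: coloring_map.
have finS := finite_colorings Gquandle f D.
split.
  exact: (uprod_transfer_all (order_gt0 f) (@map_colors_order _ _ _ f) finS cS
    h_bij hw).
exact: (sum_orbits_transfer (order_gt0 f) (@map_colors_order _ _ _ f) cS
    h_bij h_map hw).
Qed.

End Transfer.

(** * Cohomologous cocycles *)

Section Cohomology.
Variables (R : realType) (G : finType) (op : G -> G -> G) (n : nat).
Hypothesis Gquandle : quandle op.
Variables (f : {perm G}) (D : diagram R n).
Variables (K : comUnitRingType) (psi : G -> units K).
Implicit Types (A : colors R G n) (p : 'I_n * R).

Definition ratio A p : units K :=
  umul (psi (before A p)) (uinv (psi (after A p))).

(** On each circle the ratios telescope from just after the base point to just before its return;
    the ratio at the base point closes the circle. *)
Lemma uprod_ratio A : coloring op D f A ->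
  \uprod_(p \in nonsimple D) ratio A p = uone K.
Proof.
move=> cA; have /(coloringP Gquandle)[A1 As Aeq _] := cA.
have /finite_seqP[s sE] := finite_nonsimple D.
(* One sorted list serves all circles: it gathers the parameters in (0, 1) of the nonsimple points
   of every component, and the ratio is 1 wherever such a parameter is simple. *)
pose F := sort <=%R (undup [seq x <- [seq p.2 | p <- s] | 0 < x]).
have memF x : (x \in F) = (0 < x) && (x \in [seq p.2 | p <- s]).
  by rewrite mem_sort mem_undup mem_filter.
have F01 x : x \in F -> 0 < x < 1.
  rewrite memF => /andP[-> /mapP[p ps ->]].
  have : nonsimple D p by rewrite sE.
  by case=> /andP[].
have sortF : sorted <%R F by rewrite sort_lt_sorted undup_uniq.
have uniqF : uniq (0 :: F).
  rewrite /= sort_uniq undup_uniq andbT.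
  by apply/negP => /F01; rewrite ltxx.
have [F0 F0E] : exists F0, F0 = 0 :: F by exists (0 :: F).
rewrite (fsbig_fwiden [seq (i, x) | i <- enum 'I_n, x <- F0]).
- rewrite big_allpairs big1 // => i _; rewrite F0E big_cons.
  have As1 := stepwise_telescope psi (As i).
  have -> : \big[@umul K/uone K]_(x <- F) ratio A (i, x) =
      umul (psi (A i 0).2) (uinv (psi (A i 1).1)).
    apply: As1 => //.
    + by rewrite lt_path_sortedE sortF andbT; apply/allP => x /F01/andP[].
    + by apply/allP => x /F01/andP[].
    move=> x x01 xF; apply: Aeq; apply: contrapT => mx.
    have : nonsimple D (i, x) by split=> //=; lra.
    rewrite sE /= => xs; move: xF; rewrite memF; case/andP: x01 => -> _ /=.
    by case/mapP; exists (i, x).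
  have -> : A i 1 = A i 0 by rewrite -(A1 i 0) add0r.
  rewrite /ratio /before /after /=.
  by rewrite -umulA umulVKu umuluV.
- move=> p pN; have [p01 _] := pN; move: pN; rewrite sE /= => ps.
  case: p p01 ps => i x /= x01 xs; apply/allpairsP; exists (i, x).
  split=> //=; first by rewrite mem_enum.
  rewrite F0E inE memF; have [//|x0] := eqVneq x 0; rewrite lt_neqAle eq_sym x0 /=.
  case/andP: x01 => -> _ /=; by apply/mapP; exists (i, x).
- apply: allpairs_uniq => //; [by rewrite enum_uniq|by rewrite F0E|].
  by move=> [? ?] [? ?].
- move=> p [/= /allpairsP[[i x] /= [_ xF ->]] nN].
  rewrite /ratio /before /after /= Aeq ?umuluV //; apply: contrapT => mx.
  apply: nN; split=> //=; move: xF; rewrite F0E inE => /predU1P[->|/F01]; lra.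
Qed.

(** Chosen so that applying [f] to the coloring multiplies it by the ratio at a virtual crossing.
    Where [x] becomes [f^-1 x], the ratio is [psi x / psi (f^-1 x)] and [psi (f^-1 x)] has this
    property; where [x] becomes [f x], the inverse of [psi x] has it. *)
Definition twist A p : units K :=
  match mark D p.1 p.2 with
  | Virtual =>
      if `[< exists2 q, double (curve D) p q & from_right D p q >]
      then psi ((f^-1)%g (before A p)) else uinv (psi (before A p))
  | _ => uone K
  end.

Lemma twist_map A p : coloring op D f A -> mark D p.1 p.2 <> Under ->
  umul (ratio A p) (twist A p) = twist (map_colors f A) p.
Proof.
move=> /(coloringP Gquandle)[_ _ Aeq Adouble]; rewrite /twist => mU.
case mp: (mark D p.1 p.2) => //.
- by rewrite /ratio /before /after Aeq // umuluV umulu1.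
- have [q pq] : exists q, double (curve D) p q.
    by apply: nonsimple_double; rewrite mp.
  have := Adouble _ _ pq; rewrite mp /= /ratio => ->.
  by rewrite umuluV umulu1.
rewrite /ratio; have [/asboolP[q pq fr]|/asboolPn nfr] := ifP.
  have := Adouble _ _ pq; rewrite mp fr /= => ->.
  by rewrite -umulA umulVu umulu1 /before /= permK.
have [q pq] : exists q, double (curve D) p q.
  by apply: nonsimple_double; rewrite mp.
have nfrq : from_right D p q = false.
  by apply/negP => fr; apply: nfr; exists q.
have := Adouble _ _ pq; rewrite mp nfrq /= => ->.
by rewrite umulAC umuluV umul1u.
Qed.

Variables (phi phi' : G -> G -> units K).
Hypothesis phiE : forall x y,
  phi x y = umul (umul (psi x) (uinv (psi (op x y)))) (phi' x y).

(** A crossing contributes the quotient of [psi] on the right by [psi] on the left, to the power of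
    its sign; for both signs this is the ratio along the under-strand. Crossings are therefore
    indexed by their under-passages. *)
Lemma weight_coboundary A : coloring op D f A ->
  weight phi D A = umul (weight phi' D A)
    (\uprod_(p \in nonsimple D `&` [set p | mark D p.1 p.2 = Under]) ratio A p).
Proof.
move=> cA; have finC := finite_classical_crossings D.
have [_ _ _ Aclass _] := cA.
have bij1 : set_bij (classical_crossings D)
    (nonsimple D `&` [set p | mark D p.1 p.2 = Under]) fst.
  split.
  - by move=> [p q] [/= p01 q01 pq mp mq]; split=> //; split=> //=; rewrite mp.
  - move=> [p q] [p' q'] /=; rewrite !inE => -[/= p01 q01 pq _ _].
    move=> [/= p'01 q'01 pq' _ _] pp'; rewrite -pp' in pq' *.
    have := double_only pq pq'; rewrite same_point_norm.
    by rewrite !norm_pt_id // => ->.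
  - move=> p [[p01 /nonsimple_double[q pq]] /= mp].
    exists (p, norm_pt q) => //; split=> //=; rewrite ?frac_itv //.
      by rewrite -[p](norm_pt_id p01) double_norm.
    rewrite mark_frac; have := mark_double pq; rewrite mp.
    by move=> [] [].
rewrite (reindex_fsbig _ _ _ _ bij1) -fsbig_split //.
apply: eq_fsbigr => -[p q]; rewrite inE => -[/= p01 q01 pq mp mq].
rewrite /crossing_weight /= phiE.
have := Aclass _ _ pq mp mq; rewrite /left_color /right_color /ratio.
case: (from_right D p q) => /= <-; first by rewrite umulC.
by rewrite !uinvM uinvK umulC; congr umul; exact: umulC.
Qed.

Lemma cohomologous_related_by :
  related_by op phi phi' D D f (fun A A' => A = A')
    (fun A => \uprod_(p \in nonsimple D `&` ~` [set p | mark D p.1 p.2 = Under])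
       twist A p).
Proof.
split=> [A cA|A cA|A B A' B' _ _ _ _ -> ->|A A' ->|A _ cA _ <-] //.
- by exists A.
- by exists A.
have finN := finite_nonsimple D.
rewrite (weight_coboundary cA) -umulA; congr umul.
have := uprod_ratio cA; rewrite (fsbigID [set p | mark D p.1 p.2 = Under]) //.
set V := _ `&` ~` _ => prod1.
have finV : finite_set V by apply: finite_setIl.
have -> : \uprod_(p \in V) twist (map_colors f A) p =
    \uprod_(p \in V) umul (ratio A p) (twist A p).
  by apply: eq_fsbigr => p; rewrite inE => -[_ /= mp]; rewrite twist_map.
by rewrite (@fsbig_split _ _ _ _ V (ratio A)) //= umulA prod1 umul1u.
Qed.

End Cohomology.

(** * Chain rules and changes of parameter *)

Section ChainRule.
Variables (R : realType) (V W : normedModType R).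

Lemma derive1_comp_scale (g : R -> V) (s : R -> R) t :
  derivable s t 1 -> derivable g (s t) 1 ->
  derive1 (g \o s) t = derive1 s t *: derive1 g (s t).
Proof.
move=> /derivable1_diffP ds /derivable1_diffP dg.
rewrite !derive1E' //; last exact: differentiable_comp.
by rewrite diff_comp // -linearZ /= /GRing.scale /= mulr1.
Qed.

Lemma derive1_comp_diff (g : R -> V) (h : V -> W) t :
  derivable g t 1 -> differentiable h (g t) ->
  derive1 (h \o g) t = 'd h (g t) (derive1 g t).
Proof.
move=> /derivable1_diffP dg dh.
rewrite !derive1E' //; last exact: differentiable_comp.
by rewrite diff_comp.
Qed.

End ChainRule.

Section Reparametrization.
Variables (R : realType) (r : R -> R).
Hypothesis r_rep : reparametrization r.

Lemma reparam_int t (m : int) : r (t + m%:~R) = r t + m%:~R.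
Proof.
have [r1 _ _ _] := r_rep.
have rn k : forall t, r (t + k%:R) = r t + k%:R.
  by elim: k => [|k IH] u; rewrite ?addr0 // -natr1 !addrA r1 IH.
case: m => k; first exact: rn.
by rewrite NegzE rmorphN /= -[in RHS](subrK k.+1%:R t) rn addrK.
Qed.

Lemma reparam_continuous : continuous r.
Proof.
have [_ rder _ _] := r_rep.
by move=> x; apply: differentiable_continuous; apply/derivable1_diffP.
Qed.

Lemma reparam_mono : {mono r : x y / x < y}.
Proof.
have [_ rder _ rpos] := r_rep; apply: leW_mono; apply: le_mono => x y xy.
apply: (@gtr0_derive1_lt_cc _ r x y) => //; rewrite ?in_itv /= ?lexx ?ltW //.
exact/continuous_subspaceT/reparam_continuous.
Qed.

Lemma reparam_inj : injective r.
Proof.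
move=> x y xy.
by have [|| //] := ltgtP x y; rewrite -reparam_mono xy ltxx.
Qed.

Lemma reparam_surj y : exists t, r t = y.
Proof.
(* The values of [r] at [m] and [m + 1] are [r 0 + m] and [r 0 + m + 1], and this [m] places [y]
   between them. *)
pose m := Num.floor (y - r 0).
have := frac_itv (y - r 0); rewrite /frac -/m => ym.
have r0 := reparam_int 0 m; have r1 := reparam_int 0 (m + 1).
rewrite !add0r intrD in r0 r1.
have [//|||t _ <-] := @IVT _ r m%:~R (m%:~R + 1) y; last by exists t.
- by lra.
- exact/continuous_subspaceT/reparam_continuous.
by rewrite r0 r1 ge_min le_max; apply/andP; split; apply/orP; [left|right]; lra.
Qed.

End Reparametrization.

(** * Ambient isotopies preserve the orientation of the plane *)

Section Jacobian.
Variable R : realType.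
Implicit Types (h : plane R -> plane R) (u v p : plane R).

Lemma cross_diff h p u v : differentiable h p ->
  cross ('d h p u) ('d h p v) =
  cross u v * cross ('D_((1, 0) : plane R) h p) ('D_((0, 1) : plane R) h p).
Proof.
move=> dh; rewrite !deriveE //.
have dE w : 'd h p w = w.1 *: 'd h p (1, 0) + w.2 *: 'd h p (0, 1).
  rewrite -!linearZ -linearD; congr ('d h p _); case: w => x y.
  by congr pair; rewrite /= /GRing.scale /= ?mulr1 ?mulr0 ?addr0 ?add0r.
rewrite (dE u) (dE v) /cross /= /GRing.scale /=.
set a := 'd h p (1, 0); set b := 'd h p (0, 1).
ring.
Qed.

(** The Jacobian of [H s] at [p] is continuous in [s], never zero, and equal to 1 at [s = 0], so the
    intermediate value theorem excludes a nonpositive value at [s = 1]. *)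
Lemma isotopy_jacobian_gt0 (H : R -> plane R -> plane R) p :
  ambient_isotopy H ->
  0 < cross ('D_((1, 0) : plane R) (H 1) p) ('D_((0, 1) : plane R) (H 1) p).
Proof.
move=> [H0 _ _ _ [dHc dHn0]].
pose J s := cross ('D_((1, 0) : plane R) (H s) p)
                  ('D_((0, 1) : plane R) (H s) p).
have dc (v : plane R) : continuous (fun s => 'D_v (H s) p).
  move=> s; have sp : (fun s' => (s', p)) x @[x --> s] --> (s, p).
    exact: (cvg_pair (@cvg_id _ (nbhs s)) (cvg_cst p)).
  exact: (continuous_comp sp (dHc v (s, p))).
have Jc : continuous J.
  move=> s; rewrite /J /cross.
  have c1 (v : plane R) : {for s, continuous (fun s => ('D_v (H s) p).1)}.
    by apply: (continuous_comp (dc v s)); apply: cvg_fst.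
  have c2 (v : plane R) : {for s, continuous (fun s => ('D_v (H s) p).2)}.
    by apply: (continuous_comp (dc v s)); apply: cvg_snd.
  by apply: cvgB; apply: cvgM; [apply: c1|apply: c2|apply: c2|apply: c1].
have J0 : J 0 = 1.
  have -> : J 0 = cross (1, 0) (0, 1).
    by rewrite /J; have -> : H 0 = id by [apply/funext]; rewrite !derive_id.
  by rewrite /cross /=; lra.
rewrite ltNge; apply/negP => J1.
have [//||//|c _ /eqP] := @IVT _ J 0 1 0.
- exact: continuous_subspaceT.
- by rewrite J0 ge_min J1 orbT le_max ler01.
by rewrite (negbTE (dHn0 _ _)).
Qed.

End Jacobian.

(** * Invariance under planar isotopy *)

Section PlanarIsotopy.
Variables (R : realType) (G : finType) (op : G -> G -> G) (n : nat).
Hypothesis Gquandle : quandle op.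
Variables (f : {perm G}) (K : comUnitRingType) (phi : G -> G -> units K).
Variables (D D' : diagram R n).
Variables (H : R -> plane R -> plane R) (sigma : {perm 'I_n}).
Variable r : 'I_n -> R -> R.
Hypothesis H_iso : ambient_isotopy H.
Hypothesis r_rep : forall i, reparametrization (r i).
Hypothesis curveE : forall i t, curve D' (sigma i) (r i t) = H 1 (curve D i t).
Hypothesis markE : forall i t, mark D' (sigma i) (r i t) = mark D i t.
Implicit Types (p q : 'I_n * R) (A : colors R G n).

Definition moved_pt p : 'I_n * R := (sigma p.1, r p.1 p.2).

Lemma moved_pt_surj p : exists q, moved_pt q = p.
Proof.
case: p => i t; have [s sE] := reparam_surj (r_rep ((sigma^-1)%g i)) t.
by exists ((sigma^-1)%g i, s); rewrite /moved_pt /= permKV sE.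
Qed.

Lemma same_point_moved p q :
  same_point (moved_pt p) (moved_pt q) <-> same_point p q.
Proof.
case: p q => i s [j t]; rewrite /same_point /moved_pt /=; split=> -[].
  move=> /perm_inj <- [m]; rewrite -(reparam_int (r_rep i)).
  by move=> /(reparam_inj (r_rep i)) ->; split=> //; exists m.
by move=> <- [m ->]; split=> //; exists m; rewrite (reparam_int (r_rep i)).
Qed.

Lemma double_moved p q :
  double (curve D') (moved_pt p) (moved_pt q) <-> double (curve D) p q.
Proof.
have [_ /(_ 1)/bij_inj H_inj _ _ _] := H_iso.
rewrite /double same_point_moved /= !curveE; split=> -[pq e]; split=> //.
  exact: H_inj.
by rewrite e.
Qed.

Lemma velocity_moved p : derive1 (r p.1) p.2 *: velocity D' (moved_pt p) =
  'd (H 1) (curve D p.1 p.2) (velocity D p).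
Proof.
case: p => i t; rewrite /velocity /moved_pt /=.
have dr : derivable (r i) t 1 by have [_ + _ _] := r_rep i; apply.
have dH : differentiable (H 1) (curve D i t) by have [_ _ _ + _] := H_iso.
rewrite -derive1_comp_diff //; last exact: curve_derivable.
rewrite -derive1_comp_scale //; last exact: curve_derivable.
by congr (derive1 _ t); apply/funext => s /=; rewrite curveE.
Qed.

(** Up to the positive speeds of the parameter changes, both velocities are transported by the
    differential of [H 1] at the same point, which multiplies [cross] by a positive Jacobian. *)
Lemma from_right_moved p q : double (curve D) p q ->
  from_right D' (moved_pt p) (moved_pt q) = from_right D p q.
Proof.
move=> [_ pq]; rewrite /from_right.
have rpos (s : 'I_n * R) : 0 < derive1 (r s.1) s.2 by have [_ _ _ ->] := r_rep s.1.
have crossZ (a b : R) (u v : plane R) :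
    cross (a *: u) (b *: v) = (a * b) * cross u v.
  by rewrite /cross /= /GRing.scale /=; ring.
have dH : differentiable (H 1) (curve D q.1 q.2) by have [_ _ _ + _] := H_iso.
rewrite -(pmulr_rgt0 _ (mulr_gt0 (rpos q) (rpos p))) -crossZ !velocity_moved pq.
by rewrite cross_diff // pmulr_lgt0 // isotopy_jacobian_gt0.
Qed.

Definition moved_colors A A' : Prop :=
  forall i t, A' (sigma i) (r i t) = A i t.

Lemma coloring_moved A A' : moved_colors A A' ->
  coloring op D f A <-> coloring op D' f A'.
Proof.
move=> AA'.
have bE p : before A' (moved_pt p) = before A p by rewrite /before /= AA'.
have aE p : after A' (moved_pt p) = after A p by rewrite /after /= AA'.
have endE i t : arc_end D' (sigma i) (r i t) <-> arc_end D i t.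
  by rewrite /arc_end markE.
have surj i t : exists j s, i = sigma j /\ t = r j s.
  by have [[j s] [<- <-]] := moved_pt_surj (i, t); exists j, s.
have mono i := reparam_mono (r_rep i).
have r1 i t : r i (t + 1) = r i t + 1 by have [-> _ _ _] := r_rep i.
have leftE p q : double (curve D) p q ->
    left_color D' A' (moved_pt p) (moved_pt q) = left_color D A p q.
  by move=> pq; rewrite /left_color from_right_moved // bE aE.
have rightE p q : double (curve D) p q ->
    right_color D' A' (moved_pt p) (moved_pt q) = right_color D A p q.
  by move=> pq; rewrite /right_color from_right_moved // bE aE.
split=> -[A1 Aeq Aconst Aclass Avirt]; split.
- move=> i' t'; have [i [t [-> ->]]] := surj i' t'.
  by rewrite -r1 !AA' A1.
- move=> i' t'; have [i [t [-> ->]]] := surj i' t'.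
  by rewrite endE -[(_, _)]/(moved_pt (i, t)) bE aE; apply: Aeq.
- move=> i' s' t'; have [i [t [-> ->]]] := surj i' t'.
  have [s <-] := reparam_surj (r_rep i) s'; rewrite mono => st nost.
  rewrite -[(_, r i s)]/(moved_pt (i, s)) -[(_, r i t)]/(moved_pt (i, t)).
  by rewrite aE bE; apply: Aconst => // x sxt; rewrite -endE; apply: nost;
     rewrite !mono.
- move=> p' q'; have [[p <-] [q <-]] := (moved_pt_surj p', moved_pt_surj q').
  rewrite double_moved /= !markE => pq mp mq.
  by rewrite leftE // rightE // aE; apply: Aclass.
- move=> p' q'; have [[p <-] [q <-]] := (moved_pt_surj p', moved_pt_surj q').
  rewrite double_moved /= !markE => pq mp.
  by rewrite bE aE from_right_moved //; apply: Avirt.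
- by move=> i t; rewrite -!AA' r1 A1.
- by move=> i t; rewrite -endE -bE -aE; apply: Aeq.
- move=> i s t st nost; rewrite -aE -bE; apply: Aconst; first by rewrite mono.
  move=> x'; have [x <-] := reparam_surj (r_rep i) x'.
  by rewrite !mono endE; apply: nost.
- move=> p q pq mp mq; rewrite -leftE // -rightE // -aE.
  by apply: Aclass => /=; rewrite ?markE //; apply/double_moved.
- move=> p q pq mp; rewrite -bE -aE -from_right_moved //.
  by apply: Avirt => /=; rewrite ?markE //; apply/double_moved.
Qed.

Lemma weight_moved A A' : coloring op D f A -> coloring op D' f A' ->
  moved_colors A A' -> weight phi D' A' = weight phi D A.
Proof.
move=> cA cA' AA'.
(* A change of parameter may leave [0, 1), so crossings are matched after normalization. *)
pose N (c : ('I_n * R) * ('I_n * R)) :=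
  (norm_pt (moved_pt c.1), norm_pt (moved_pt c.2)).
have N_inj p q : 0 <= p.2 < 1 -> 0 <= q.2 < 1 ->
    norm_pt (moved_pt p) = norm_pt (moved_pt q) -> p = q.
  move=> p01 q01 /same_point_norm/same_point_moved/same_point_norm.
  by rewrite !norm_pt_id.
have N_bij : set_bij (classical_crossings D) (classical_crossings D') N.
  split.
  - move=> [p q] [/= p01 q01 pq mp mq]; split; rewrite /= ?frac_itv //.
    + by apply/double_norm/double_moved.
    + by rewrite mark_frac markE.
    + by rewrite mark_frac markE.
  - move=> [p q] [p' q']; rewrite !inE => -[/= p01 q01 _ _ _].
    move=> [/= p01' q01' _ _ _]; rewrite /N /= => /pair_equal_spec[e1 e2].
    by rewrite (N_inj p p') // (N_inj q q').
  - move=> [p' q'] [/= p01 q01].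
    have [[p pE] [q qE]] := (moved_pt_surj p', moved_pt_surj q').
    rewrite -pE -qE in p01 q01 *; rewrite double_moved /= !markE => pq mp mq.
    exists (norm_pt p, norm_pt q).
      by split; rewrite /= ?frac_itv ?mark_frac //; apply/double_norm.
    rewrite /N /=; congr pair; rewrite -[RHS]norm_pt_id //.
      by apply/same_point_norm/same_point_moved/same_point_norm;
         rewrite /norm_pt /= frac_frac.
    by apply/same_point_norm/same_point_moved/same_point_norm;
       rewrite /norm_pt /= frac_frac.
rewrite /weight (reindex_fsbig _ _ _ _ N_bij).
apply: eq_fsbigr => -[p q]; rewrite inE => -[_ _ /= pq _ _].
rewrite /crossing_weight /N /= /right_color !from_right_norm from_right_moved //.
by rewrite /before /after /= !(coloring_frac cA') !AA'.
Qed.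

Lemma moved_related_by : related_by op phi phi D D' f moved_colors
  (fun=> uone K).
Proof.
split.
- move=> A cA; pose pre p := xget p [set q | moved_pt q = p].
  have preK p : moved_pt (pre p) = p.
    by rewrite /pre; case: xgetP => // H0; have [q /H0] := moved_pt_surj p.
  have moved_inj p q : moved_pt p = moved_pt q -> p = q.
    case: p q => i s [j t] [/perm_inj -> /(reparam_inj (r_rep _))] -> //.
  pose A' i t := A (pre (i, t)).1 (pre (i, t)).2.
  have AA' : moved_colors A A'.
    move=> i t; rewrite /A'; have -> : pre (sigma i, r i t) = (i, t) by
      apply: moved_inj; rewrite preK.
    by [].
  by exists A' => //; apply/(coloring_moved AA').
- move=> A' cA'; pose A i t := A' (sigma i) (r i t).
  have AA' : moved_colors A A' by [].
  by exists A => //; apply/(coloring_moved AA').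
- move=> A B A' B' _ _ _ _ AA' BB'; split=> [AB|AB].
    apply/funext => i; apply/funext => t.
    have [[j s] [<- <-]] := moved_pt_surj (i, t).
    by rewrite AA' BB' AB.
  by apply/funext => i; apply/funext => t; rewrite -AA' -BB' AB.
- by move=> A A' AA' i t; rewrite /map_colors AA'.
- by move=> A A' cA cA' AA'; rewrite (weight_moved cA cA').
Qed.

End PlanarIsotopy.

(** * Changing a diagram and its coloring inside the disc *)

Section LocalChange.
Variables (R : realType) (G : finType) (op : G -> G -> G) (n m : nat).
Hypothesis Gquandle : quandle op.
Variables (f : {perm G}) (k : 'I_m -> 'I_n) (a b : 'I_m -> R).
Implicit Types (E D : diagram R n) (p q : 'I_n * R) (j l : 'I_m).
Implicit Types (A : colors R G n) (C : 'I_m -> R -> G * G).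

Definition in_strand (p : 'I_n * R) : Prop :=
  exists j, p.1 = k j /\ a j <= frac p.2 <= b j.

Definition strand_pt (d : 'I_m * R) : 'I_n * R := (k d.1, d.2).

Section Strands.
Variable E : diagram R n.
Hypothesis E_strands : strands k a b E.

Lemma strand_bounds j : [/\ 0 < a j, a j < b j & b j < 1].
Proof. by have [] := E_strands. Qed.

Lemma strand_itv j x : a j <= x <= b j -> 0 <= x < 1.
Proof. by have [] := strand_bounds j; lra. Qed.

Lemma strand_frac j x : a j <= x <= b j -> frac x = x.
Proof. by move=> /strand_itv /frac_id. Qed.

Lemma strand_uniq j l x y : k j = k l -> a j <= x <= b j -> a l <= y <= b l ->
  x = y -> j = l.
Proof.
have [_ disj _] := E_strands => kjl xj yl xy; apply/eqP; apply: contrapT => /negP.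
by move=> /disj /(_ kjl); lra.
Qed.

Lemma in_strandP p : in_strand p <->
  (curve E p.1 p.2).1 ^+ 2 + (curve E p.1 p.2).2 ^+ 2 <= 1.
Proof.
have [_ _ disc] := E_strands.
by rewrite -[curve E _ _]curve_frac disc ?frac_itv.
Qed.

(** Lying on a strand means that the image point is in the disc, and the two passages of a double
    point have the same image. *)
Lemma in_strand_double p q : double (curve E) p q ->
  in_strand p <-> in_strand q.
Proof. by move=> [_ pq]; rewrite !in_strandP pq. Qed.

Lemma near_out_strand i t : ~ in_strand (i, t) ->
  \forall x \near t, ~ in_strand (i, x).
Proof.
move=> it.
have H j : \forall x \near t, i = k j -> ~~ (a j <= frac x <= b j).
  have [ij|ij] := eqVneq i (k j); last first.
    by apply/near_eps; exists 1 => // x _ ij'; rewrite ij' eqxx in ij.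
  have [a0 ab b1] := strand_bounds j.
  have /(near_frac_out a0 ab b1) H : ~~ (a j <= frac t <= b j).
    by apply/negP => tj; apply: it; exists j.
  by near=> x => _; near: x.
have {}H : \forall x \near t, forall j, i = k j -> ~~ (a j <= frac x <= b j).
  exact: (filter_forall (nbhs_filter t) H).
apply: filterS H => x Hx [j [ij xj]].
by have /negP := Hx j ij.
Unshelve. all: by end_near. Qed.

Lemma near_other_strand j t : a j <= frac t <= b j ->
  \forall x \near t, forall l, l != j -> k l = k j -> ~~ (a l <= frac x <= b l).
Proof.
move=> tj.
have H l : \forall x \near t, l != j -> k l = k j -> ~~ (a l <= frac x <= b l).
  have [lj|lj] := eqVneq l j.
    by apply/near_eps; exists 1.
  have [klj|klj] := eqVneq (k l) (k j); last first.
    by apply/near_eps; exists 1 => // x _ _ e; rewrite e eqxx in klj.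
  have [a0 ab b1] := strand_bounds l.
  have /(near_frac_out a0 ab b1) H : ~~ (a l <= frac t <= b l).
    by apply/negP => tl; case/eqP: lj; exact: (strand_uniq klj tl tj).
  by near=> x => _ _; near: x.
exact: (filter_forall (nbhs_filter t) H).
Unshelve. all: by end_near. Qed.

Lemma double_strand (d e : 'I_m * R) : a d.1 <= d.2 <= b d.1 ->
  a e.1 <= e.2 <= b e.1 -> d <> e ->
  curve E (k d.1) d.2 = curve E (k e.1) e.2 ->
  double (curve E) (strand_pt d) (strand_pt e).
Proof.
case: d e => j x [l y] /= xj yl de c; split=> //.
rewrite same_point_norm /norm_pt /= (strand_frac xj) (strand_frac yl) => -[kjl xy].
by apply: de; rewrite (strand_uniq kjl xj yl xy) xy.
Qed.

Lemma strand_double_inj (d e e' : 'I_m * R) : a e.1 <= e.2 <= b e.1 ->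
  a e'.1 <= e'.2 <= b e'.1 ->
  double (curve E) (strand_pt d) (strand_pt e) ->
  double (curve E) (strand_pt d) (strand_pt e') -> e = e'.
Proof.
case: e e' => l y [l' y'] /= yl yl' de de'.
have := double_only de de'; rewrite same_point_norm /norm_pt /=.
rewrite (strand_frac yl) (strand_frac yl') => -[kll yy].
by rewrite (strand_uniq kll yl yl' yy) yy.
Qed.

End Strands.

Definition strand_coloring E C : Prop :=
  [/\ forall j, stepwise (C j),
      forall j x, a j <= x <= b j -> mark E (k j) x = Simple ->
        (C j x).1 = (C j x).2
    & forall j x l y, a j <= x <= b j -> a l <= y <= b l ->
        double (curve E) (k j, x) (k l, y) ->
        (C j x).2 = passed op f (mark E (k j) x)
                      (from_right E (k j, x) (k l, y)) (C j x).1 (C l y).2].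

Lemma coloring_strand E A : coloring op E f A ->
  strand_coloring E (fun j => A (k j)).
Proof.
move=> /(coloringP Gquandle)[A1 As Aeq Ad]; split=> //.
- by move=> j x _; apply: Aeq.
- by move=> j x l y _ _ /Ad.
Qed.

Section Glue.
Variables (D D' : diagram R n).
Hypothesis DD' : local_change k a b D D'.

Let D_strands : strands k a b D. Proof. by have [] := DD'. Qed.
Let D'_strands : strands k a b D'. Proof. by have [] := DD'. Qed.

Lemma outside_agree i t : ~ in_strand (i, t) ->
  curve D i t = curve D' i t /\ mark D i t = mark D' i t.
Proof.
move=> it; have [_ _ /(_ i (frac t) (frac_itv t))] := DD'.
by rewrite !curve_frac !mark_frac; apply=> -[j [ij tj]]; apply: it; exists j.
Qed.

(** The strands are closed, so the curves coincide on a whole neighborhood of the parameter. *)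
Lemma outside_velocity p : ~ in_strand p -> velocity D p = velocity D' p.
Proof.
case: p => i t /(near_out_strand D_strands) nt.
rewrite /velocity /= !derive1E; apply: near_eq_derive.
by apply: filterS nt => x /outside_agree[].
Qed.

Lemma outside_from_right p q : ~ in_strand p -> ~ in_strand q ->
  from_right D p q = from_right D' p q.
Proof. by move=> op' oq; rewrite /from_right !outside_velocity. Qed.

Lemma outside_double p q : ~ in_strand p -> ~ in_strand q ->
  double (curve D) p q <-> double (curve D') p q.
Proof.
case: p q => i s [j t] /outside_agree[p1 _] /outside_agree[q1 _].
by rewrite /double /= p1 q1.
Qed.

Definition glue A C : colors R G n := fun i t =>
  if [pick j | (k j == i) && (a j <= frac t <= b j)] is Some j
  then C j (frac t) else A i t.

Lemma glue_in A C j t : a j <= frac t <= b j -> glue A C (k j) t = C j (frac t).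
Proof.
move=> tj; rewrite /glue; case: pickP => [l /andP[/eqP kl tl]|/(_ j)].
  by rewrite (strand_uniq D_strands kl tl tj).
by rewrite eqxx tj.
Qed.

Lemma glue_out A C i t : ~ in_strand (i, t) -> glue A C i t = A i t.
Proof.
move=> it; rewrite /glue; case: pickP => // l /andP[/eqP kl tl].
by case: it; exists l.
Qed.

(** Away from the ends of the strands the glued function is locally [A] or [C], and double points do
    not mix inside and outside. At an end the two one-sided values come from different functions,
    which agree there. *)
Lemma glue_coloring A C : coloring op D f A -> strand_coloring D' C ->
  (forall j, C j (a j) = A (k j) (a j)) -> (forall j, C j (b j) = A (k j) (b j)) ->
  coloring op D' f (glue A C).
Proof.
move=> cA [Cs Ceq Cd] Ca Cb; have /(coloringP Gquandle)[A1 As Aeq Ad] := cA.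
apply/(coloringP Gquandle); split.
- move=> i t; have [[j [/= -> tj]]|it] := pselect (in_strand (i, t)).
    by have := fracD t 1 => t1; rewrite !glue_in ?t1.
  rewrite !glue_out // => -[j [ij tj]]; apply: it; exists j; split=> //.
  by have := fracD t 1 => <-.
- move=> i t; have [[j [/= -> tj]]|it] := pselect (in_strand (i, t)); last first.
    have H := @filterI _ _ (nbhs_filter t) _ _ (near_out_strand D_strands it) (As i t).
    by apply: (@filterS _ _ (nbhs_filter t)) H => x [ix xA]; rewrite !glue_out.
  have [a0 ab b1] := strand_bounds D_strands j.
  set m0 : R := (Num.floor t)%:~R.
  have tE : frac t = t - m0 by [].
  have N1 : \forall x \near t, frac x = x - m0.
    by apply: near_frac; move: tj; lra.
  have N2 := near_other_strand D_strands tj.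
  have N3 : \forall x \near t,
      (frac t < x - m0 -> C j (x - m0) = ((C j (frac t)).2, (C j (frac t)).2)) /\
      (x - m0 < frac t -> C j (x - m0) = ((C j (frac t)).1, (C j (frac t)).1)).
    have /near_eps[e e0 He] := Cs j (frac t).
    by apply/near_eps; exists e => // x xe; apply: He; rewrite tE; lra.
  have outP x : (forall l, l != j -> k l = k j -> ~~ (a l <= frac x <= b l)) ->
      ~~ (a j <= frac x <= b j) -> ~ in_strand (k j, x).
    move=> xo xj [l [/= jl xl]]; have [lj|lj] := eqVneq l j.
      by rewrite lj (negbTE xj) in xl.
    by move: xl; rewrite (negbTE (xo l lj _)).
  have AC y : frac t = y -> C j y = A (k j) y -> A (k j) t = C j (frac t).
    by move=> ty CA; rewrite ty CA -(coloring_frac cA _ t) ty.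
  near=> x.
  have xE : frac x = x - m0 by near: x.
  have xo : forall l, l != j -> k l = k j -> ~~ (a l <= frac x <= b l).
    by near: x.
  have [Cr Cl] : (frac t < x - m0 ->
      C j (x - m0) = ((C j (frac t)).2, (C j (frac t)).2)) /\
      (x - m0 < frac t -> C j (x - m0) = ((C j (frac t)).1, (C j (frac t)).1)).
    by near: x.
  have [Ar Al] : (t < x -> A (k j) x = ((A (k j) t).2, (A (k j) t).2)) /\
      (x < t -> A (k j) x = ((A (k j) t).1, (A (k j) t).1)).
    by near: x; apply: As.
  (* If [x] is near [t], to its right, and already beyond the end of the strand, then [t] is that
     end; [Bl] is the mirror image at the beginning. *)
  have Br : t < x -> (b j + m0 < x) = (b j + m0 <= t).
    move=> tx; suff : t < x -> (b j + m0 < x) = (b j + m0 <= t) /\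
      (b j + m0 <= x) = (b j + m0 <= t) by move=> /(_ tx)[].
    by near: x; apply: (@filterS _ _ (nbhs_filter t)) (near_le (b j + m0) t) => y [].
  have Bl : x < t -> (a j + m0 <= x) = (a j + m0 < t).
    move=> tx; suff : x < t -> (a j + m0 < x) = (a j + m0 < t) /\
      (a j + m0 <= x) = (a j + m0 < t) by move=> /(_ tx)[].
    by near: x; apply: (@filterS _ _ (nbhs_filter t)) (near_le (a j + m0) t) => y [].
  rewrite (glue_in _ _ tj); split=> xt.
    have [xb|xb] := leP (frac x) (b j).
      rewrite glue_in; last by move: tj; rewrite xE in xb *; lra.
      by rewrite xE; apply: Cr; lra.
    have tb : frac t = b j.
      have := Br xt; have -> : b j + m0 < x by rewrite xE in xb; lra.
      by move=> /esym bt; move: tj; lra.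
    rewrite glue_out; last by apply: outP => //; apply/negP; lra.
    by rewrite Ar // (AC _ tb).
  have [xa|xa] := leP (a j) (frac x).
    rewrite glue_in; last by move: tj; rewrite xE in xa *; lra.
    by rewrite xE; apply: Cl; lra.
  have ta : frac t = a j.
    have := Bl xt; have -> : (a j + m0 <= x) = false.
      by apply/negbTE; rewrite -ltNge; rewrite xE in xa; lra.
    by move=> /esym/negbT; rewrite -leNgt => bt; move: tj; lra.
  rewrite glue_out; last by apply: outP => //; apply/negP; lra.
  by rewrite Al // (AC _ ta).
- move=> i t; have [[j [/= -> tj]]|it] := pselect (in_strand (i, t)).
    by rewrite -mark_frac glue_in //; apply: Ceq.
  by rewrite glue_out // -(proj2 (outside_agree it)); apply: Aeq.
- move=> p q pq; have [|op'] := pselect (in_strand p).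
    move=> /[dup] /(in_strand_double D'_strands pq).
    case: p q pq => i s [i' t] pq [l [/= li tl]] [j [/= ji sj]]; subst i i'.
    rewrite /before /after /= !glue_in //.
    have /double_norm pq' := pq; have := Cd _ _ _ _ sj tl pq'.
    by rewrite mark_frac -[from_right _ _ _]/(from_right D' (norm_pt (k j, s))
      (norm_pt (k l, t))) from_right_norm.
  have oq : ~ in_strand q by move=> /(in_strand_double D'_strands pq).
  have pq' : double (curve D) p q by apply/outside_double.
  case: p q op' oq pq pq' => i s [i' t] op' oq pq pq'.
  rewrite /before /after /= !glue_out // -outside_from_right //.
  have [_ <-] := outside_agree op'.
  by have := Ad _ _ pq'; rewrite /before /after /=.
Unshelve. all: by end_near. Qed.
End Glue.
End LocalChange.

(** * Colorings of the disc determined by the incoming colors *)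

Section LocalSolutions.
Variables (R : realType) (G : finType) (op : G -> G -> G) (n m : nat).
Hypothesis Gquandle : quandle op.
Variables (f : {perm G}) (k : 'I_m -> 'I_n) (a b : 'I_m -> R).
Variables (K : comUnitRingType) (phi : G -> G -> units K).
Implicit Types (E D : diagram R n) (j l : 'I_m) (A : colors R G n).
Implicit Types (x : 'I_m -> G) (B : ('I_m -> G) -> 'I_m -> R -> G * G).
Implicit Types X : seq (('I_m * R) * ('I_m * R)).

(* B x is the only coloring of the strands in the disc that has color x j at
   the beginning of strand j; X lists the classical crossings in the disc. *)
Record local_solution E (out : ('I_m -> G) -> 'I_m -> G) B X : Prop :=
  LocalSolution {
    ls_coloring : forall x, strand_coloring op f k a b E (B x);
    ls_begin : forall x j, B x j (a j) = (x j, x j);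
    ls_end : forall x j, B x j (b j) = (out x j, out x j);
    ls_unique : forall x C, strand_coloring op f k a b E C ->
      (forall j, (C j (a j)).1 = x j) ->
      forall j y, a j <= y <= b j -> C j y = B x j y;
    ls_uniq : uniq X;
    ls_inside : forall d, d \in X ->
      a d.1.1 <= d.1.2 <= b d.1.1 /\ a d.2.1 <= d.2.2 <= b d.2.1;
    ls_crossings : forall c, classical_crossings E c /\ in_strand k a b c.1 <->
      c \in [seq (strand_pt k d.1, strand_pt k d.2) | d <- X] }.

Definition local_weight E B X x : units K :=
  \big[@umul K/uone K]_(d <- X)
    wt op phi (from_right E (strand_pt k d.1) (strand_pt k d.2))
      (B x d.1.1 d.1.2).1 (B x d.2.1 d.2.2).2.

Definition inputs A j : G := before A (k j, a j).

Section OneDiagram.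
Variables (E : diagram R n) (out : ('I_m -> G) -> 'I_m -> G).
Variables (B : ('I_m -> G) -> 'I_m -> R -> G * G).
Variable X : seq (('I_m * R) * ('I_m * R)).
Hypothesis E_strands : strands k a b E.
Hypothesis solB : local_solution E out B X.

Lemma solution_strand A j y : coloring op E f A -> a j <= y <= b j ->
  A (k j) y = B (inputs A) j y.
Proof.
move=> cA; have sA := coloring_strand Gquandle k a b cA.
exact: (ls_unique solB sA (fun l => erefl)).
Qed.

Definition outside_crossings : set (('I_n * R) * ('I_n * R)) :=
  classical_crossings E `&` [set c | ~ in_strand k a b c.1].

(** The incoming colors determine the coloring of the strands, so the crossings in the disc
    contribute a function of these colors alone. *)
Lemma weight_local A : coloring op E f A ->
  weight phi E A = umul (local_weight E B X (inputs A))
    (\uprod_(c \in outside_crossings) crossing_weight phi E A c).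
Proof.
move=> cA; pose inside := [set c : ('I_n * R) * ('I_n * R) | in_strand k a b c.1].
rewrite /weight (fsbigID inside); last exact: finite_classical_crossings.
congr umul; pose XX := [seq (strand_pt k d.1, strand_pt k d.2) | d <- X].
have inX d : d \in X -> [/\ 0 <= d.1.2 < 1, 0 <= d.2.2 < 1,
    in_strand k a b (strand_pt k d.1) & in_strand k a b (strand_pt k d.2)].
  move=> /(ls_inside solB)[d1 d2]; split.
  - exact: (strand_itv E_strands d1).
  - exact: (strand_itv E_strands d2).
  - by exists d.1.1; split=> //=; rewrite (strand_frac E_strands d1).
  - by exists d.2.1; split=> //=; rewrite (strand_frac E_strands d2).
have XX_uniq : uniq XX.
  rewrite map_inj_in_uniq ?(ls_uniq solB) // => -[[j s] [l t]] [[j' s'] [l' t']].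
  move=> /(ls_inside solB)/= [d1 d2] /(ls_inside solB)/= [d1' d2'].
  rewrite /strand_pt /= => -[kj ss kl tt].
  by rewrite (strand_uniq E_strands kj d1 d1' ss) ss
             (strand_uniq E_strands kl d2 d2' tt) tt.
have -> : classical_crossings E `&` inside = [set` XX].
  by apply/seteqP; split=> c; rewrite /= /XX -(ls_crossings solB).
rewrite -fsbig_seq // big_map /local_weight !big_seq; apply: eq_bigr => d dX.
have [d1 d2] := ls_inside solB dX.
have [] : classical_crossings E (strand_pt k d.1, strand_pt k d.2) /\
    in_strand k a b (strand_pt k d.1).
  apply: (proj2 (ls_crossings solB (strand_pt k d.1, strand_pt k d.2))).
  by apply/mapP; exists d.
move=> cd _; rewrite (crossing_weightE Gquandle _ cA) //=.
by rewrite /before /after /= !solution_strand.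
Qed.

Lemma solution_agree A A' : coloring op E f A -> coloring op E f A' ->
  (forall i t, 0 <= t < 1 -> (forall j, i = k j -> ~ (a j < t < b j)) ->
    A i t = A' i t) -> A = A'.
Proof.
move=> cA cA' AA'.
have inp : inputs A = inputs A'.
  apply/funext => j; rewrite /inputs /before AA' //=.
    by have [] := strand_bounds E_strands j; lra.
  move=> l jl; have [//|lj] := eqVneq l j; first by move=> ->; rewrite ltxx.
  have [] := strand_bounds E_strands j => a0 ab b1 aj.
  case/eqP: lj; have al : a l <= a j <= b l by lra.
  have aj' : a j <= a j <= b j by lra.
  exact: (strand_uniq E_strands (esym jl) al aj' erefl).
apply/funext => i; apply/funext => t.
rewrite -(coloring_frac cA) -(coloring_frac cA').
have [[j [/= -> tj]]|it] := pselect (in_strand k a b (i, t)).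
  by rewrite (solution_strand cA tj) (solution_strand cA' tj) inp.
apply: AA'; first exact: frac_itv.
move=> j ij tj; apply: it; exists j; split=> //=; lra.
Qed.

End OneDiagram.

(** The end points [a j] and [b j] are included, so related colorings share their incoming
    colors. *)
Definition agree_off_strands A A' : Prop := forall i t, 0 <= t < 1 ->
  (forall j, i = k j -> ~ (a j < t < b j)) -> A i t = A' i t.

Lemma agree_sym A A' : agree_off_strands A A' -> agree_off_strands A' A.
Proof. by move=> AA' i t t01 H; rewrite AA'. Qed.

Lemma local_change_sym D D' : local_change k a b D D' ->
  local_change k a b D' D.
Proof.
by move=> [sD sD' ag]; split=> // i t t01 /(ag i t t01)[-> ->].
Qed.

(** The strands are recolored from the same incoming colors, and the result can be glued in because
    both solutions have the same outgoing colors [out]. *)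
Lemma solution_extend D D' out B B' X X' A : local_change k a b D D' ->
  local_solution D out B X -> local_solution D' out B' X' ->
  coloring op D f A -> exists2 A', coloring op D' f A' & agree_off_strands A A'.
Proof.
move=> DD' solB solB' cA; have [D_strands D'_strands _] := DD'.
have Ba j : B' (inputs A) j (a j) = A (k j) (a j).
  have [a0 ab b1] := strand_bounds D_strands j.
  rewrite (ls_begin solB') (solution_strand solB) ?(ls_begin solB) //; lra.
have Bb j : B' (inputs A) j (b j) = A (k j) (b j).
  have [a0 ab b1] := strand_bounds D_strands j.
  rewrite (ls_end solB') (solution_strand solB) ?(ls_end solB) //; lra.
exists (glue k a b A (B' (inputs A))).
  exact: (glue_coloring Gquandle DD' cA (ls_coloring solB' _)).
move=> i t t01 tout.
have [[j [/= ij tj]]|it] := pselect (in_strand k a b (i, t)); last first.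
  by rewrite glue_out.
have ntj := tout _ ij; rewrite ij (glue_in DD' _ _ tj).
rewrite (frac_id t01) in tj *.
have [->|->] : t = a j \/ t = b j.
- have [|at_] := eqVneq t (a j); [by left|right].
  apply/eqP; have [//|tb] := eqVneq t (b j).
  by case: ntj; rewrite !lt_neqAle tb eq_sym at_.
- by rewrite Ba.
- by rewrite Bb.
Qed.

(** Outside the disc the crossings, their signs and the colors are unchanged, and applying [f] to a
    coloring applies it to the inputs; what remains of a move is an identity in the incoming
    colors. *)
Lemma local_related_by D D' out B B' X X' (v : ('I_m -> G) -> units K) :
  local_change k a b D D' ->
  local_solution D out B X -> local_solution D' out B' X' ->
  (forall x, umul (local_weight D' B' X' x) (v x) =
             umul (local_weight D B X x) (v (f \o x))) ->
  related_by op phi phi D D' f agree_off_strands (fun A => v (inputs A)).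
Proof.
move=> DD' solB solB' weightB; have [D_strands D'_strands _] := DD'.
split.
- by move=> A; apply: solution_extend DD' solB solB'.
- move=> A' /(solution_extend (local_change_sym DD') solB' solB)[A cA A'A].
  by exists A => //; apply: agree_sym.
- move=> A1 A2 A1' A2' c1 c2 c1' c2' ag1 ag2; split=> e.
    apply: (solution_agree D'_strands solB') => // i t t01 it.
    by rewrite -ag1 // -ag2 // e.
  apply: (solution_agree D_strands solB) => // i t t01 it.
  by rewrite ag1 // ag2 // e.
- by move=> A A' AA' i t t01 it; rewrite /map_colors AA'.
move=> A A' cA cA' AA'.
have inp : inputs A' = inputs A.
  have [A2 cA2 AA2] := solution_extend DD' solB solB' cA.
  apply/funext => j; rewrite /inputs /before -AA' //=.
    by have [] := strand_bounds D_strands j; lra.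
  move=> l jl; have [->|lj] := eqVneq l j; first by rewrite ltxx.
  have [] := strand_bounds D_strands j => a0 ab b1 aj.
  case/eqP: lj; have al : a l <= a j <= b l by lra.
  have aj' : a j <= a j <= b j by lra.
  exact: (strand_uniq D_strands (esym jl) al aj' erefl).
rewrite (weight_local D_strands solB cA) (weight_local D'_strands solB' cA') inp.
rewrite umulAC weightB umulAC; congr (umul (umul _ _) _).
have -> : outside_crossings D' = outside_crossings D.
  have H E1 E2 : local_change k a b E1 E2 ->
      outside_crossings E1 `<=` outside_crossings E2.
    move=> EE [p q] [[/= p01 q01 pq mp mq] op']; have [sE _ _] := EE.
    have oq : ~ in_strand k a b q by move=> /(in_strand_double sE pq).
    split=> //; split=> //=; first exact/(outside_double EE).
      case: p op' mp {p01 pq} => i s op' mp.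
      by rewrite -(proj2 (outside_agree EE op')).
    case: q oq mq {q01 pq} => i s oq mq.
    by rewrite -(proj2 (outside_agree EE oq)).
  by apply/seteqP; split; apply: H => //; apply: local_change_sym.
apply: eq_fsbigr => -[p q]; rewrite inE => -[[/= p01 q01 pq mp mq] op'].
have oq : ~ in_strand k a b q by move=> /(in_strand_double D_strands pq).
have off (p0 : 'I_n * R) : 0 <= p0.2 < 1 -> ~ in_strand k a b p0 ->
    A' p0.1 p0.2 = A p0.1 p0.2.
  move=> p001 op0; rewrite AA' // => j pj pin; apply: op0; exists j.
  by split=> //; rewrite frac_id //; lra.
rewrite /crossing_weight /= /right_color (outside_from_right DD') //.
by rewrite /before /after !off.
Qed.

End LocalSolutions.

(** * Local solutions from the list of crossings in the disc *)

Section CrossingPairs.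
Variables (R : realType) (G : finType) (op : G -> G -> G) (n m : nat).
Variables (f : {perm G}) (k : 'I_m -> 'I_n) (a b : 'I_m -> R).
Variable E : diagram R n.
Hypothesis E_strands : strands k a b E.
Implicit Types (j l : 'I_m) (d e : 'I_m * R) (C : 'I_m -> R -> G * G).
Implicit Types (P : seq (('I_m * R) * ('I_m * R))).

Definition is_under (mk : passage) : bool := if mk is Under then true else false.

(* P lists the crossings in the disc; at classical ones, the first strand is
   the lower one. *)
Record crossing_pairs P : Prop := CrossingPairs {
  cp_inside : forall d e, (d, e) \in P ->
    a d.1 < d.2 < b d.1 /\ a e.1 < e.2 < b e.1;
  cp_double : forall d e, (d, e) \in P ->
    double (curve E) (strand_pt k d) (strand_pt k e);
  cp_not_over : forall d e, (d, e) \in P -> mark E (k d.1) d.2 <> Over;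
  cp_all : forall j y, a j <= y <= b j -> mark E (k j) y <> Simple ->
    exists e, (((j, y), e) \in P) \/ ((e, (j, y)) \in P) }.

Definition rule_at C d e : Prop :=
  (C d.1 d.2).2 = passed op f (mark E (k d.1) d.2)
    (from_right E (strand_pt k d) (strand_pt k e)) (C d.1 d.2).1 (C e.1 e.2).2.

Section Pairs.
Variable P : seq (('I_m * R) * ('I_m * R)).
Hypothesis cpP : crossing_pairs P.

Lemma cp_inside_le d e : (d, e) \in P ->
  a d.1 <= d.2 <= b d.1 /\ a e.1 <= e.2 <= b e.1.
Proof. by move=> /(cp_inside cpP); lra. Qed.

Lemma strand_coloring_pairs C : (forall j, stepwise (C j)) ->
  (forall j y, a j <= y <= b j -> mark E (k j) y = Simple -> (C j y).1 = (C j y).2) ->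
  (forall d e, (d, e) \in P -> rule_at C d e /\ rule_at C e d) ->
  strand_coloring op f k a b E C.
Proof.
move=> Cs Ceq CP; split=> // j y l z yj zl de.
have [e [eP|eP]] := cp_all cpP yj (double_nonsimple de).
  have [_ ein] := cp_inside_le eP.
  have jy := cp_double cpP eP.
  have lz := strand_double_inj E_strands (e := e) (e' := (l, z)) ein zl jy de.
  by have [] := CP _ _ eP; rewrite lz.
have [ein _] := cp_inside_le eP.
have ed := double_sym (cp_double cpP eP).
have lz := strand_double_inj E_strands (e := e) (e' := (l, z)) ein zl ed de.
by have [_] := CP _ _ eP; rewrite lz.
Qed.

Lemma crossings_pairs c : classical_crossings E c /\ in_strand k a b c.1 <->
  c \in [seq (strand_pt k de.1, strand_pt k de.2)
        | de <- [seq de <- P | is_under (mark E (k de.1.1) de.1.2)]].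
Proof.
split=> [[]|/mapP[[d e]]].
  case: c => -[i s] q [/= s01 q01 pq mp mq] ps.
  have [l [ql zl]] : in_strand k a b q by apply/(in_strand_double E_strands pq).
  have [j [/= ij yj]] := ps; rewrite frac_id // in yj; rewrite frac_id // in zl.
  rewrite {i}ij in pq mp ps *.
  have [e [eP|eP]] : exists e, (((j, s), e) \in P) \/ ((e, (j, s)) \in P).
    by apply: (cp_all cpP) => //; rewrite mp.
    have [_ ein] := cp_inside_le eP.
    have qE : q = strand_pt k (l, q.2) by case: q ql {q01 pq mq zl} => ? ? /= ->.
    have lz : e = (l, q.2).
      apply: (strand_double_inj E_strands (d := (j, s))) => //=.
        exact: (cp_double cpP eP).
      by rewrite -qE.
    apply/mapP; exists ((j, s), e); first by rewrite mem_filter eP andbT /= mp.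
    by rewrite /= lz -qE.
  case: (cp_not_over cpP eP).
  have := mark_double (cp_double cpP eP); rewrite /= mp.
  by move=> [] [].
rewrite mem_filter => /andP[/= mu deP] ->.
have [din ein] := cp_inside_le deP; have de := cp_double cpP deP.
split; last by exists d.1; rewrite /= (strand_frac E_strands din).
have md : mark E (k d.1) d.2 = Under by case: (mark E (k d.1) d.2) mu.
split=> //=; try exact: (strand_itv E_strands).
- exact: (strand_itv E_strands din).
- exact: (strand_itv E_strands ein).
by have := mark_double de; rewrite /= md => -[] [].
Qed.

Lemma local_solution_pairs out B : uniq P ->
  (forall x j, stepwise (B x j)) ->
  (forall x j y, a j <= y <= b j -> mark E (k j) y = Simple ->
    (B x j y).1 = (B x j y).2) ->
  (forall x d e, (d, e) \in P -> rule_at (B x) d e /\ rule_at (B x) e d) ->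
  (forall x j, B x j (a j) = (x j, x j)) ->
  (forall x j, B x j (b j) = (out x j, out x j)) ->
  (forall x C, strand_coloring op f k a b E C -> (forall j, (C j (a j)).1 = x j) ->
      forall j y, a j <= y <= b j -> C j y = B x j y) ->
  local_solution op f k a b E out B
    [seq de <- P | is_under (mark E (k de.1.1) de.1.2)].
Proof.
move=> uP Bs Beq BP Ba Bb Buniq; split=> //.
- by move=> x; exact: (strand_coloring_pairs (Bs x) (Beq x) (BP x)).
- exact: filter_uniq.
- by move=> [d e]; rewrite mem_filter => /andP[_ /cp_inside_le].
- exact: crossings_pairs.
Qed.

(* The strands can be colored one after the other when each of them only passes
   under strands of smaller rank. *)
Lemma strand_coloring_unique (rank : 'I_m -> nat) C C' :
  (forall d e, (d, e) \in P -> mark E (k d.1) d.2 = Under ->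
    (rank e.1 < rank d.1)%N) ->
  strand_coloring op f k a b E C -> strand_coloring op f k a b E C' ->
  (forall j, (C j (a j)).1 = (C' j (a j)).1) ->
  forall j y, a j <= y <= b j -> C j y = C' j y.
Proof.
move=> rankP [Cs Ceq Cd] [Cs' Ceq' Cd'] CC' j.
have [N] := ubnP (rank j); elim: N => // N IH in j * => rj.
apply: stepwise_unique => // y yj CCy.
have [m0|m0] := pselect (mark E (k j) y = Simple).
  by rewrite -Ceq // -Ceq'.
have [[l z] [eP|eP]] := cp_all cpP yj m0.
  have [_ zl] := cp_inside_le eP; have de := cp_double cpP eP.
  rewrite (Cd _ _ _ _ yj zl de) (Cd' _ _ _ _ yj zl de) CCy.
  (* Only at an under-passage does the rule involve the other strand, whose coloring is known by
     induction on the rank. *)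
  case md: (mark E (k j) y) => //=; rewrite (IH l) //.
  by have /= := rankP _ _ eP md; move=> /leq_trans; apply; rewrite -ltnS.
have [zl _] := cp_inside_le eP; have de := double_sym (cp_double cpP eP).
rewrite (Cd _ _ _ _ yj zl de) (Cd' _ _ _ _ yj zl de) CCy.
case md: (mark E (k j) y) => //=; case: (cp_not_over cpP eP).
by have := mark_double (cp_double cpP eP); rewrite /= md => -[] [].
Qed.

End Pairs.

Lemma two_stepsE (p q y : R) (h : bool -> bool -> G) : y != p -> y != q ->
  two_steps p q h y = (h (p < y) (q < y), h (p < y) (q < y)).
Proof. by move=> yp yq; rewrite /two_steps !(le_eqVlt _ y) ![_ == y]eq_sym
  (negbTE yp) (negbTE yq). Qed.

Lemma two_steps_fst (p q : R) (h : bool -> bool -> G) : p != q ->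
  two_steps p q h p = (h false (q < p), h true (q < p)).
Proof. by move=> pq; rewrite /two_steps ltxx lexx !(le_eqVlt q) eq_sym
  (negbTE pq). Qed.

Lemma two_steps_snd (p q : R) (h : bool -> bool -> G) : p != q ->
  two_steps p q h q = (h (p < q) false, h (p < q) true).
Proof. by move=> pq; rewrite /two_steps ltxx lexx !(le_eqVlt p) (negbTE pq). Qed.

(** Existence is reduced to the rules at the listed pairs, since no jump occurs at a simple point;
    uniqueness comes from the rank. The outgoing color is the value once both points are passed. *)
Lemma two_steps_solution P (rank : 'I_m -> nat) (p q : 'I_m -> R)
    (h : ('I_m -> G) -> 'I_m -> bool -> bool -> G) :
  let B x j := two_steps (p j) (q j) (h x j) in
  crossing_pairs P -> uniq P ->
  (forall d e, (d, e) \in P -> mark E (k d.1) d.2 = Under ->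
    (rank e.1 < rank d.1)%N) ->
  (forall j, [/\ a j < p j < b j, a j < q j < b j, p j != q j,
     mark E (k j) (p j) <> Simple & mark E (k j) (q j) <> Simple]) ->
  (forall x j, h x j false false = x j) ->
  (forall x d e, (d, e) \in P -> rule_at (B x) d e /\ rule_at (B x) e d) ->
  local_solution op f k a b E (fun x j => h x j true true) B
    [seq de <- P | is_under (mark E (k de.1.1) de.1.2)].
Proof.
move=> B cpP uP rankP pqP h0 BP.
have Bs x j : stepwise (B x j) by apply: two_steps_stepwise.
have Ba x j : B x j (a j) = (x j, x j).
  have [/andP[pj _] /andP[qj _] _ _ _] := pqP j.
  by rewrite /B two_stepsE ?lt_eqF // !ltNge (ltW pj) (ltW qj) h0.
have Bb x j : B x j (b j) = (h x j true true, h x j true true).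
  have [/andP[_ pj] /andP[_ qj] _ _ _] := pqP j.
  by rewrite /B two_stepsE ?gt_eqF // pj qj.
have Beq x j y : a j <= y <= b j -> mark E (k j) y = Simple ->
    (B x j y).1 = (B x j y).2.
  move=> yj m0; have [_ _ _ mp mq] := pqP j.
  by rewrite /B two_stepsE //; apply/eqP => yE; rewrite -yE in mp mq.
apply: local_solution_pairs => // x C cC Cx.
apply: (strand_coloring_unique cpP rankP cC).
  exact: (strand_coloring_pairs cpP (Bs x) (Beq x) (BP x)).
by move=> j; rewrite Cx Ba.
Qed.

Lemma simple_solution :
  (forall j y, a j <= y <= b j -> mark E (k j) y = Simple) ->
  local_solution op f k a b E (fun x j => x j) (fun x j _ => (x j, x j)) [::].
Proof.
move=> allS; have cpP : crossing_pairs [::] by split=> // j y /allS.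
have Cs x j : stepwise (fun=> (x j, x j) : G * G) by apply: stepwise_cst.
have := @local_solution_pairs [::] cpP (fun x j => x j)
  (fun x j _ => (x j, x j)).
apply=> // x C cC Cx; apply: (strand_coloring_unique cpP (rank := fun=> 0%N)) => //.
exact: (strand_coloring_pairs cpP).
Qed.

End CrossingPairs.

(** * The first move *)

Definition toggled (G : Type) (T : bool -> G -> G) (e b : bool) (y : G) : G :=
  if b then T e y else y.

Section Move1.
Variables (R : realType) (G : finType) (op : G -> G -> G) (n : nat).
Hypothesis Gquandle : quandle op.
Variable f : {perm G}.

(** Needed for a kink whose under-passage comes before its over-passage: the color [y] leaving the
    under-passage is then also the color of the over-strand. *)
Lemma act_fix e x y : y = act op e x y -> x = y.
Proof. by move=> yE; rewrite -(actK Gquandle e x y) -yE (actxx Gquandle). Qed.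

Variables (k : 'I_1 -> 'I_n) (j0 : 'I_1) (a b : 'I_1 -> R) (D' : diagram R n) (s t : R).
Hypothesis D'_strands : strands k a b D'.
Hypotheses (as_ : a j0 < s) (st : s < t) (tb : t < b j0).
Hypothesis curve_st : curve D' (k j0) s = curve D' (k j0) t.
Hypothesis simple_st : forall x, a j0 <= x <= b j0 -> x <> s -> x <> t ->
  mark D' (k j0) x = Simple.

Let ordE (j : 'I_1) : j = j0. Proof. by rewrite (ord1 j) (ord1 j0). Qed.
Let sab : a j0 <= s <= b j0.
Proof. by rewrite ltW //= ltW // (lt_trans st). Qed.
Let tab : a j0 <= t <= b j0.
Proof. by rewrite ltW ?(lt_trans as_) //= ltW. Qed.

Let st_order : [/\ a j0 < s, s < t & t < b j0]. Proof. by []. Qed.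

Let double_st : double (curve D') (k j0, s) (k j0, t).
Proof.
apply: (double_strand D'_strands (d := (j0, s)) (e := (j0, t))) => //.
by case=> sE; move: st; rewrite sE ltxx.
Qed.

Lemma kink_pairs d e : mark D' (k d.1) d.2 <> Over ->
  (d, e) = ((j0, s), (j0, t)) \/ (d, e) = ((j0, t), (j0, s)) ->
  crossing_pairs k a b D' [:: (d, e)].
Proof.
move=> mdO de; have [as' st' tb'] := st_order; split.
- move=> d' e'; rewrite inE => /eqP[-> ->].
  by case: de => -[-> ->] /=; lra.
- move=> d' e'; rewrite inE => /eqP[-> ->].
  by case: de => -[-> ->] //; apply: double_sym.
- by move=> d' e'; rewrite inE => /eqP[-> _].
move=> j y; rewrite (ordE j) => yab my.
have [->|yt] : y = s \/ y = t.
- apply: contrapT => /not_orP[ys yt]; exact/my/simple_st.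
- case: de => -[-> ->]; first by exists (j0, t); left; rewrite inE.
  by exists (j0, t); right; rewrite inE.
rewrite yt; case: de => -[-> ->]; last by exists (j0, s); left; rewrite inE.
by exists (j0, s); right; rewrite inE.
Qed.

Lemma kink_classical_solution d e : mark D' (k d.1) d.2 = Under ->
  (d, e) = ((j0, s), (j0, t)) \/ (d, e) = ((j0, t), (j0, s)) ->
  local_solution op f k a b D' (fun x j => x j) (fun x j _ => (x j, x j))
    [:: (d, e)].
Proof.
have [as' st' tb'] := st_order; move=> md de; have mdO : mark D' (k d.1) d.2 <> Over by rewrite md.
have cpP := kink_pairs mdO de.
have d_e : double (curve D') (strand_pt k d) (strand_pt k e).
  by apply: (cp_double cpP); rewrite inE.
have me : mark D' (k e.1) e.2 = Over.
  by have := mark_double d_e; rewrite /= md => -[] [].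
have d0 : d.1 = e.1 by case: de => -[-> ->].
have := @local_solution_pairs _ _ op _ _ f _ _ _ _ D'_strands _ cpP
  (fun x j => x j) (fun x j _ => (x j, x j)).
rewrite /= md /=; apply=> //.
- by move=> x j; apply: stepwise_cst.
- move=> x d' e'; rewrite inE => /eqP[-> ->].
  by rewrite /rule_at /= me md /= -d0 (actxx Gquandle).
move=> x C cC Cx; have [Cs Ceq Cd] := cC.
have dab : a d.1 <= d.2 <= b d.1 /\ a e.1 <= e.2 <= b e.1.
  by apply: (cp_inside_le cpP); rewrite inE.
have CdE := Cd _ _ _ _ (proj1 dab) (proj2 dab) d_e.
have CeE := Cd _ _ _ _ (proj2 dab) (proj1 dab) (double_sym d_e).
rewrite md me /= in CdE CeE.
(* The strand passes under itself, so no rank is available. Constancy between [s] and [t] compares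
   its lower passage with its upper one instead. *)
have Cst : (C j0 s).2 = (C j0 t).1.
  apply: stepwise_const => // y yst; apply: Ceq; first by lra.
  by apply: simple_st; lra.
have fixd : (C d.1 d.2).2 = (C d.1 d.2).1.
  move: CdE CeE; case: de => -[-> ->] /= CdE CeE.
    by apply/esym/act_fix; rewrite {1}CdE CeE -Cst.
  by rewrite CdE Cst (actxx Gquandle).
move=> j y; rewrite (ordE j) => yab.
apply: (@stepwise_unique _ _ _ (fun=> (x j0, x j0)) (a j0) (b j0)) => //.
  exact: stepwise_cst.
move=> {y yab} y yab /= <-.
have [m0|m0] := pselect (mark D' (k j0) y = Simple); first by rewrite Ceq.
have [ys|yt] : y = s \/ y = t.
- by apply: contrapT => /not_orP[ys yt]; exact/m0/simple_st.
- by rewrite ys; move: fixd CeE; case: de => -[-> ->].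
by rewrite yt; move: fixd CeE; case: de => -[-> ->].
Qed.

(** The two passages cross each other in opposite directions, so one applies [f] and the other its
    inverse. *)
Lemma kink_virtual_solution : mark D' (k j0) s = Virtual ->
  exists B, local_solution op f k a b D' (fun x j => x j) B [::].
Proof.
move=> ms; have msO : mark D' (k ((j0, s) : 'I_1 * R).1) s <> Over by rewrite ms.
have cpP := @kink_pairs (j0, s) (j0, t) msO (or_introl erefl).
have mt : mark D' (k j0) t = Virtual.
  by have := mark_double double_st; rewrite /= ms => -[] [].
pose e := from_right D' (k j0, s) (k j0, t).
pose h (x : 'I_1 -> G) (j : 'I_1) b1 b2 :=
  toggled (vact f) e b1 (toggled (vact f) (~~ e) b2 (x j)).
have st' : s != t by rewrite lt_eqF.
have [as' st2 tb'] := st_order.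
have := @two_steps_solution _ _ op _ _ f _ _ _ _ D'_strands _ (fun=> 0%N)
  (fun=> s) (fun=> t) h cpP.
have outE : (fun x j => h x j true true) = (fun x j => x j).
  by apply/funext => x; apply/funext => j; rewrite /h /toggled vactNK.
rewrite outE /= ms /= => H; eexists; apply: H => //.
- by move=> d' e'; rewrite inE => /eqP[-> _] /=; rewrite ms.
- move=> j; rewrite (ordE j) ms mt; split=> //; lra.
- move=> x d' e'; rewrite inE => /eqP[-> ->].
  rewrite /rule_at /two_steps /= ms mt /= !ltxx !lexx st (ltW st).
  rewrite !(leNgt t s) st (ltNge t s) (ltW st) /=.
  by rewrite (from_rightN double_st) -/e /h /toggled vactK vactNK.
Qed.

End Move1.

Section Move1Invariance.
Variables (R : realType) (G : finType) (op : G -> G -> G) (n : nat).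
Hypothesis Gquandle : quandle op.
Variables (K : comUnitRingType) (phi : G -> G -> units K).
Hypothesis phi_cocycle : cocycle op phi.
Variable f : {perm G}.

Lemma move1_related (D D' : diagram R n) : move1 D D' ->
  exists rel v, related_by op phi phi D D' f rel v.
Proof.
move=> [k [a [b [s [t [DD' simpleD [as_ st tb] curve_st simpleD']]]]]].
have [D_strands D'_strands _] := DD'.
have solD : local_solution op f k a b D (fun x j => x j)
    (fun x j _ => (x j, x j)) [::].
  by apply: simple_solution => // j y; rewrite (ord1 j); apply: simpleD.
suff [B [X [solD' wD']]] : exists B X,
    local_solution op f k a b D' (fun x j => x j) B X /\
    forall x, local_weight op k phi D' B X x = uone K.
  exists (agree_off_strands k a b), (fun A => uone K).
  apply: (local_related_by Gquandle (v := fun=> uone K) DD' solD solD') => x.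
  by rewrite wD' /local_weight big_nil.
have double_st : double (curve D') (k 0, s) (k 0, t).
  apply: (double_strand D'_strands (d := (0, s)) (e := (0, t))) => /=.
  - by rewrite ltW //= ltW // (lt_trans st).
  - by rewrite ltW ?(lt_trans as_) //= ltW.
  - by case=> sE; move: st; rewrite sE ltxx.
  - exact: curve_st.
have classical (d e : 'I_1 * R) : mark D' (k d.1) d.2 = Under ->
    (d, e) = ((0, s), (0, t)) \/ (d, e) = ((0, t), (0, s)) ->
    exists B X, local_solution op f k a b D' (fun x j => x j) B X /\
    forall x, local_weight op k phi D' B X x = uone K.
  move=> md de; exists (fun x j _ => (x j, x j)), [:: (d, e)]; split.
    exact: (kink_classical_solution Gquandle f D'_strands as_ st tb).
  move=> x; rewrite /local_weight big_seq1 /=.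
  have -> : e.1 = d.1 by rewrite (ord1 d.1) (ord1 e.1).
  exact: wtxx.
have := mark_double double_st; move=> [] [ms mt].
- by apply: (classical (0, t) (0, s)) => //; right.
- by apply: (classical (0, s) (0, t)) => //; left.
have [B solB] := kink_virtual_solution op f D'_strands as_ st tb curve_st simpleD' ms.
by exists B, [::]; split=> // x; rewrite /local_weight big_nil.
Qed.

End Move1Invariance.

(** * The second move *)

Lemma toggledC (G : Type) (T : bool -> G -> G) :
  (forall e y, T (~~ e) (T e y) = y) -> (forall e y, T e (T (~~ e) y) = y) ->
  forall e b y, T (~~ e) (toggled T e b y) = toggled T e b (T (~~ e) y).
Proof. by move=> TK TNK e [] y; rewrite /toggled ?TK ?TNK. Qed.

Section Move2.
Variables (R : realType) (G : finType) (op : G -> G -> G) (n : nat).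
Hypothesis Gquandle : quandle op.
Variables (K : comUnitRingType) (phi : G -> G -> units K).
Hypothesis phi_cocycle : cocycle op phi.
Variable f : {perm G}.

(** Strand [u] crosses [o] at [t] and [t'] in opposite directions, so the two actions on its color
    are mutually inverse and the two weights cancel, whichever crossing comes first on either
    strand. *)
Lemma clasp_solution (k : 'I_2 -> 'I_n) (a b : 'I_2 -> R) (D' : diagram R n)
    (o u : 'I_2) (s t s' t' : R) :
  strands k a b D' -> o != u -> s != s' -> t != t' ->
  a o < s < b o -> a o < s' < b o -> a u < t < b u -> a u < t' < b u ->
  curve D' (k o) s = curve D' (k u) t -> curve D' (k o) s' = curve D' (k u) t' ->
  from_right D' (k o, s) (k u, t) != from_right D' (k o, s') (k u, t') ->
  mark D' (k o) s = mark D' (k o) s' -> mark D' (k o) s <> Under ->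
  (forall x, a o <= x <= b o -> x <> s -> x <> s' -> mark D' (k o) x = Simple) ->
  (forall x, a u <= x <= b u -> x <> t -> x <> t' -> mark D' (k u) x = Simple) ->
  exists B X, local_solution op f k a b D' (fun x j => x j) B X /\
    forall x, local_weight op k phi D' B X x = uone K.
Proof.
move=> D'_strands ou ss tt so so' tu tu' c c' fr mss msU simo simu.
have ouE j : j = o \/ j = u.
  case: j o u ou {so so' tu tu' c c' fr mss msU simo simu} =>
    [[|[|//]] pj] [[|[|//]] po] [[|[|//]] pu] //= _;
  by [left; apply: val_inj|right; apply: val_inj].
have uo : (u == o) = false by rewrite eq_sym (negbTE ou).
have d1 : double (curve D') (k u, t) (k o, s).
  apply: (double_strand D'_strands (d := (u, t)) (e := (o, s))) => //=.
  - lra.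
  - lra.
  - by case=> e; rewrite e eqxx in uo.
have d2 : double (curve D') (k u, t') (k o, s').
  apply: (double_strand D'_strands (d := (u, t')) (e := (o, s'))) => //=.
  - lra.
  - lra.
  - by case=> e; rewrite e eqxx in uo.
pose P : seq (('I_2 * R) * ('I_2 * R)) := [:: ((u, t), (o, s)); ((u, t'), (o, s'))].
have uP : uniq P.
  by rewrite /= inE andbT; apply/eqP => -[tE _]; rewrite tE eqxx in tt.
have m1 := mark_double d1; have m2 := mark_double d2.
have cpP : crossing_pairs k a b D' P.
  split.
  - by move=> d e; rewrite !inE => /orP[] /eqP[-> ->].
  - by move=> d e; rewrite !inE => /orP[] /eqP[-> ->].
  - move=> d e; rewrite !inE => /orP[] /eqP[-> _] /= mu.
      by move: m1; rewrite /= mu => -[] [] // _ /msU.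
    by move: m2; rewrite /= mu => -[] [] // _; rewrite -mss => /msU.
  move=> j y; have [->|->] := ouE j => yj my.
    have [->|ys] := eqVneq y s.
      by exists (u, t); right; rewrite !inE eqxx.
    have [->|ys'] := eqVneq y s'.
      by exists (u, t'); right; rewrite !inE eqxx orbT.
    by case: my; apply: simo => //; apply/eqP.
  have [->|yt] := eqVneq y t.
    by exists (o, s); left; rewrite !inE eqxx.
  have [->|yt'] := eqVneq y t'.
    by exists (o, s'); left; rewrite !inE eqxx orbT.
  by case: my; apply: simu => //; apply/eqP.
pose e := from_right D' (k u, t) (k o, s).
have fr1 : from_right D' (k o, s) (k u, t) = ~~ e by rewrite (from_rightN d1).
have fr2 : from_right D' (k u, t') (k o, s') = ~~ e.
  move: fr; rewrite fr1 (from_rightN d2).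
  by case: (from_right D' (k u, t') (k o, s')) (e) => [] [].
have fr2' : from_right D' (k o, s') (k u, t') = e.
  by rewrite (from_rightN d2) fr2 negbK.
have frE : from_right D' (k u, t) (k o, s) = e by [].
clearbody e.
pose p j := if j == o then s else t.
pose q j := if j == o then s' else t'.
have pqP j : [/\ a j < p j < b j, a j < q j < b j, p j != q j,
    mark D' (k j) (p j) <> Simple & mark D' (k j) (q j) <> Simple].
  have n1 : mark D' (k u) t <> Simple := double_nonsimple d1.
  have n2 : mark D' (k u) t' <> Simple := double_nonsimple d2.
  have n3 : mark D' (k o) s <> Simple := double_nonsimple (double_sym d1).
  have n4 : mark D' (k o) s' <> Simple := double_nonsimple (double_sym d2).
  by rewrite /p /q; have [->|->] := ouE j; [rewrite eqxx|rewrite uo]; split.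
pose rank j : nat := j != o.
have tlt : (t' <= t) = (t' < t) by rewrite le_eqVlt eq_sym (negbTE tt).
have tlt' : (t <= t') = (t < t') by rewrite le_eqVlt (negbTE tt).
have slt : (s' <= s) = (s' < s) by rewrite le_eqVlt eq_sym (negbTE ss).
have slt' : (s <= s') = (s < s') by rewrite le_eqVlt (negbTE ss).
have rankP d e0 : (d, e0) \in P -> mark D' (k d.1) d.2 = Under ->
    (rank e0.1 < rank d.1)%N.
  by rewrite !inE => /orP[] /eqP[-> ->] _; rewrite /rank /= uo eqxx.
case mo: (mark D' (k o) s) msU => // _.
- by move: m1; rewrite /= mo => -[] [].
- have mo' : mark D' (k o) s' = Over by rewrite -mss.
  have mu : mark D' (k u) t = Under by move: m1; rewrite /= mo => -[] [].
  have mu' : mark D' (k u) t' = Under by move: m2; rewrite /= mo' => -[] [].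
  pose T (x : 'I_2 -> G) e y := act op e y (x o).
  have TK x e' y : T x (~~ e') (T x e' y) = y by rewrite /T actK.
  have TNK x e' y : T x e' (T x (~~ e') y) = y by rewrite /T actNK.
  pose h x j b1 b2 := if j == o then x j else
    toggled (T x) e b1 (toggled (T x) (~~ e) b2 (x j)).
  exists (fun x j => two_steps (p j) (q j) (h x j)), P; split; last first.
    move=> x; rewrite /local_weight /P big_cons big_seq1 /= frE fr2.
    rewrite /two_steps /p /q /h uo eqxx /= !ltxx.
    have [t_t'|t't|tE] := ltgtP t t'; last by rewrite tE eqxx in tt.
      by rewrite /toggled wtN.
    rewrite /toggled umulC -{2}(negbK e).
    exact: (wtN Gquandle phi (~~ e) (x u) (x o)).
  have := @two_steps_solution _ _ op _ _ f _ _ _ _ D'_strands _ rank p q h cpP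
    uP rankP pqP.
  rewrite /P /= mu mu' /=.
  have -> : (fun x j => h x j true true) = (fun x j => x j).
    apply/funext => x; apply/funext => j; rewrite /h.
    by case: eqP => // _; rewrite /toggled TNK.
  apply=> [x j|x d e0]; first by rewrite /h; case: eqP.
  rewrite !inE => /orP[] /eqP[-> ->]; rewrite /rule_at /two_steps /p /q /h /=
    !eqxx !uo ?mo ?mo' ?mu ?mu' /= ?ltxx ?lexx ?frE ?fr2; split=> //.
  + by rewrite tlt.
  + by rewrite tlt' -/(T x _ _) (toggledC (TK x) (TNK x)).
- have mo' : mark D' (k o) s' = Virtual by rewrite -mss.
  have mu : mark D' (k u) t = Virtual by move: m1; rewrite /= mo => -[] [].
  have mu' : mark D' (k u) t' = Virtual by move: m2; rewrite /= mo' => -[] [].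
  pose h (x : 'I_2 -> G) j b1 b2 := if j == o
    then toggled (vact f) (~~ e) b1 (toggled (vact f) e b2 (x j))
    else toggled (vact f) e b1 (toggled (vact f) (~~ e) b2 (x j)).
  exists (fun x j => two_steps (p j) (q j) (h x j)), [::]; split; last first.
    by move=> x; rewrite /local_weight big_nil.
  have := @two_steps_solution _ _ op _ _ f _ _ _ _ D'_strands _ rank p q h cpP
    uP rankP pqP.
  rewrite /P /= mu mu' /=.
  have -> : (fun x j => h x j true true) = (fun x j => x j).
    apply/funext => x; apply/funext => j; rewrite /h.
    by case: eqP => _; rewrite /toggled ?vactNK ?vactK.
  apply=> [x j|x d e0]; first by rewrite /h; case: eqP.
  rewrite !inE => /orP[] /eqP[-> ->]; rewrite /rule_at /two_steps /p /q /h /=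
    !eqxx !uo ?mo ?mo' ?mu ?mu' /= ?ltxx ?lexx ?frE ?fr1 ?fr2 ?fr2' ?tlt ?tlt'
    ?slt ?slt'; split=> //; rewrite /toggled; case: (_ < _) => //; rewrite vactC //.
Qed.

Lemma move2_related (D D' : diagram R n) : move2 D D' ->
  exists rel v, related_by op phi phi D D' f rel v.
Proof.
move=> [k [a [b [s [t [s' [t' [DD' simpleD [s0 s0' t1 t1' [ss tt]]
  [c c' fr mss] [sim0 sim1]]]]]]]]].
have [D_strands D'_strands _] := DD'.
have solD := simple_solution op f D_strands simpleD.
suff [B [X [solD' wD']]] : exists B X,
    local_solution op f k a b D' (fun x j => x j) B X /\
    forall x, local_weight op k phi D' B X x = uone K.
  exists (agree_off_strands k a b), (fun A => uone K).
  apply: (local_related_by Gquandle (v := fun=> uone K) DD' solD solD') => x.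
  by rewrite wD' /local_weight big_nil.
have d1 : double (curve D') (k 0, s) (k 1, t).
  by apply: (double_strand D'_strands (d := (0, s)) (e := (1, t))) => //=; lra.
have d2 : double (curve D') (k 0, s') (k 1, t').
  by apply: (double_strand D'_strands (d := (0, s')) (e := (1, t'))) => //=; lra.
(* If strand 0 is the lower one, the two strands exchange their roles, which reverses the direction
   at both crossings. *)
have [m0|m0] := pselect (mark D' (k 0) s = Under); last first.
  exact: (clasp_solution D'_strands (o := 0) (u := 1)) c c' fr mss m0 sim0 sim1.
have m1 : mark D' (k 1) t = Over by have := mark_double d1; rewrite /= m0 => -[] [].
have m1' : mark D' (k 1) t' = Over.
  by have := mark_double d2; rewrite /= -mss m0 => -[] [].
have fr' : from_right D' (k 1, t) (k 0, s) != from_right D' (k 1, t') (k 0, s').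
  rewrite (from_rightN d1) (from_rightN d2).
  by move: fr; case: (from_right _ _ _); case: (from_right _ _ _).
have mtt : mark D' (k 1) t = mark D' (k 1) t' by rewrite m1 m1'.
have mtU : mark D' (k 1) t <> Under by rewrite m1.
have ne10 : (1 : 'I_2) != 0 by [].
exact: (clasp_solution D'_strands ne10 tt ss t1 t1' s0 s0' (esym c) (esym c')
  fr' mtt mtU sim1 sim0).
Qed.

End Move2.

(** * Colorings and weights of three pairwise crossing strands *)

Section Triangle.
Variables (R : realType) (G : finType) (op : G -> G -> G) (n : nat).
Hypothesis Gquandle : quandle op.
Variables (K : comUnitRingType) (phi : G -> G -> units K).
Variable f : {perm G}.
Hypothesis f_aut : quandle_aut op f.
Variables (i0 i1 i2 : 'I_3).
Hypotheses (n01 : (i0 == i1) = false) (n02 : (i0 == i2) = false).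
Hypotheses (n12 : (i1 == i2) = false).
(** [M] is the mark of [i1] and [i2] at their crossings with [i0], and [M'] that of [i2] at its
    crossing with [i1]; the three admissible pairs are the classical, virtual and mixed moves. Each
    sign tells whether the strand of larger index crosses the other from its right. *)
Variables (M M' : passage) (s01 s02 s12 : bool).
Hypothesis MM : M = Under \/ M = Virtual.
Hypothesis MM' : M' = Under \/ M' = Virtual.
Hypothesis M_under : M = Under -> M' = Under.

Let n10 : (i1 == i0) = false. Proof. by rewrite eq_sym. Qed.
Let n20 : (i2 == i0) = false. Proof. by rewrite eq_sym. Qed.
Let n21 : (i2 == i1) = false. Proof. by rewrite eq_sym. Qed.

Let I3P (j : 'I_3) : [\/ j = i0, j = i1 | j = i2].
Proof.
case: (eqVneq j i0) => [->|j0]; first by constructor 1.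
case: (eqVneq j i1) => [->|j1]; first by constructor 2.
case: (eqVneq j i2) => [->|j2]; first by constructor 3.
have : uniq [:: j; i0; i1; i2].
  by rewrite /= !inE !negb_or j0 j1 j2 n01 n02 n12.
by move=> /card_uniqP => c; have := max_card [in [:: j; i0; i1; i2]]; rewrite c card_ord.
Qed.

(* Crossing strand i0 from its right to its left acts on the colors of the other
   two strands by an automorphism of the quandle. *)
Definition cross_top (x : 'I_3 -> G) (e : bool) (y : G) : G :=
  passed op f M e y (x i0).

Lemma cross_topK x e y : cross_top x (~~ e) (cross_top x e y) = y.
Proof. by rewrite /cross_top; case: MM => -> /=; rewrite ?actK ?vactK. Qed.

Lemma cross_topNK x e y : cross_top x e (cross_top x (~~ e) y) = y.
Proof. by rewrite /cross_top; case: MM => -> /=; rewrite ?actNK ?vactNK. Qed.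

(** Self-distributivity in the classical case, [f] being an automorphism in the mixed case,
    commuting powers of [f] in the virtual case. Hence the order in which [i2] meets [i0] and [i1]
    does not affect its outgoing color. *)
Lemma cross_top_passed x e e' y z :
  cross_top x e (passed op f M' e' y z) =
  passed op f M' e' (cross_top x e y) (cross_top x e z).
Proof.
rewrite /cross_top; case: MM MM' => mE [] mE'; rewrite mE mE' /=.
- exact: act_distr.
- by move: (M_under mE); rewrite mE'.
- exact: vact_act.
- exact: vactC.
Qed.

(* The color of strand i1 at its crossing with i2 when i2 meets i1 before i0. *)
Definition middle_color (x : 'I_3 -> G) : G :=
  if s01 == s02 then x i1 else cross_top x s01 (x i1).

(** The formula for [i2] is written as if it met [i1] before [i0]. The positions of the crossings do
    not occur, so both diagrams of a move have the same outgoing colors. *)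
Definition triangle_colors (x : 'I_3 -> G) (j : 'I_3) (b1 b2 : bool) : G :=
  if j == i0 then
    if M is Under then x i0
    else toggled (vact f) (~~ s01) b1 (toggled (vact f) (~~ s02) b2 (x i0))
  else if j == i1 then
    toggled (cross_top x) s01 b1
      (if M' is Under then x i1 else toggled (vact f) (~~ s12) b2 (x i1))
  else
    toggled (cross_top x) s02 b1
      (if b2 then passed op f M' s12 (x i2) (middle_color x) else x i2).

(** For [b] saying that [i2] meets [i0] before [i1], [side] identifies the boolean on the right with
    [i1] meeting [i0] before [i2]; both members are then the color of [i1] where it meets [i2]. *)
Lemma middle_colorE x (b : bool) :
  toggled (cross_top x) s02 b (middle_color x) =
  toggled (cross_top x) s01 (b == (s01 == s02)) (x i1).
Proof.
rewrite /middle_color /toggled; have := cross_topK x; have := cross_topNK x.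
by case: b s01 s02 => [] [] [] //= TNK TK; rewrite ?(TNK true) ?(TK true).
Qed.

Variables (k : 'I_3 -> 'I_n) (a b : 'I_3 -> R) (E : diagram R n).
Variable u : 'I_3 -> 'I_3 -> R.
Hypothesis E_strands : strands k a b E.
Hypothesis E_triangle : triangle k a b u E.
Hypothesis mark10 : mark E (k i1) (u i1 i0) = M.
Hypothesis mark20 : mark E (k i2) (u i2 i0) = M.
Hypothesis mark21 : mark E (k i2) (u i2 i1) = M'.
Hypothesis s01E : from_right E (k i1, u i1 i0) (k i0, u i0 i1) = s01.
Hypothesis s02E : from_right E (k i2, u i2 i0) (k i0, u i0 i2) = s02.
Hypothesis s12E : from_right E (k i2, u i2 i1) (k i1, u i1 i2) = s12.
(** Strands [i1] and [i2] meet on one side of [i0]. If they cross [i0] in the same direction, both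
    have passed it there or neither has; otherwise exactly one has. *)
Hypothesis side : (u i1 i0 < u i1 i2) = ((u i2 i0 < u i2 i1) == (s01 == s02)).

Definition triangle_pairs : seq (('I_3 * R) * ('I_3 * R)) :=
  [:: ((i1, u i1 i0), (i0, u i0 i1)); ((i2, u i2 i0), (i0, u i0 i2));
      ((i2, u i2 i1), (i1, u i1 i2))].

(** A label and not an order: the crossing with [i0], or with [i1] on strand [i0] itself. *)
Definition first_point (j : 'I_3) : R :=
  if j == i0 then u i0 i1 else if j == i1 then u i1 i0 else u i2 i0.

Definition second_point (j : 'I_3) : R :=
  if j == i0 then u i0 i2 else if j == i1 then u i1 i2 else u i2 i1.

Lemma triangle_inside j l : j != l -> a j < u j l < b j.
Proof. by have [/(_ j l) H _] := E_triangle => /H []. Qed.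

Lemma triangle_double j l : j != l ->
  double (curve E) (k j, u j l) (k l, u l j).
Proof.
move=> jl; have [/(_ j l jl)[jin c] _] := E_triangle.
have lin : a l < u l j < b l by apply: triangle_inside; rewrite eq_sym.
apply: (double_strand E_strands (d := (j, u j l)) (e := (l, u l j))) => //=.
- by case/andP: jin => *; rewrite !ltW.
- by case/andP: lin => *; rewrite !ltW.
- by case=> e; rewrite e eqxx in jl.
Qed.

Lemma triangle_neq j l l' : j != l -> j != l' -> l != l' -> u j l != u j l'.
Proof.
move=> jl jl' ll'; apply/eqP => e.
have d := triangle_double jl; have d' := triangle_double jl'.
have lin : a l < u l j < b l by apply: triangle_inside; rewrite eq_sym.
have lin' : a l' < u l' j < b l' by apply: triangle_inside; rewrite eq_sym.
rewrite -e in d'.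
have := strand_double_inj E_strands (d := (j, u j l)) (e := (l, u l j))
  (e' := (l', u l' j)) _ _ d d' => /=.
case/andP: lin => ? ?; case/andP: lin' => ? ?.
by rewrite !ltW // => /(_ isT isT) [ll _]; rewrite ll eqxx in ll'.
Qed.

Lemma triangle_pairs_uniq : uniq triangle_pairs.
Proof.
rewrite /= !inE !negb_or andbT; apply/andP; split; first apply/andP; first split.
- by apply/eqP => /(congr1 (fun z => z.1.1)) /= e; move: n12; rewrite e eqxx.
- by apply/eqP => /(congr1 (fun z => z.1.1)) /= e; move: n12; rewrite e eqxx.
- by apply/eqP => /(congr1 (fun z => z.2.1)) /= e; move: n01; rewrite e eqxx.
Qed.

Lemma triangle_crossing_pairs : crossing_pairs k a b E triangle_pairs.
Proof.
have MO : M <> Over by case: MM => ->.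
have MO' : M' <> Over by case: MM' => ->.
split.
- move=> d e; rewrite !inE => /or3P[] /eqP[-> ->] /=; split;
  by apply: triangle_inside; rewrite ?n01 ?n02 ?n12 ?n10 ?n20 ?n21.
- move=> d e; rewrite !inE => /or3P[] /eqP[-> ->];
  by apply: triangle_double; rewrite ?n10 ?n20 ?n21.
- move=> d e; rewrite !inE => /or3P[] /eqP[-> _] /=;
  by rewrite ?mark10 ?mark20 ?mark21.
move=> j y yj my.
have [l [jl ->]] : exists l, j != l /\ y = u j l.
  have [_ Es] := E_triangle; apply: contrapT => H; apply: my.
  by apply: Es => // l jl yl; apply: H; exists l.
have [jE|jE|jE] := I3P j; have [lE|lE|lE] := I3P l;
  rewrite {}jE {}lE ?eqxx // in jl *.
- by exists (i1, u i1 i0); right; rewrite !inE eqxx.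
- by exists (i2, u i2 i0); right; rewrite !inE eqxx orbT.
- by exists (i0, u i0 i1); left; rewrite !inE eqxx.
- by exists (i2, u i2 i1); right; rewrite !inE eqxx !orbT.
- by exists (i0, u i0 i2); left; rewrite !inE eqxx orbT.
- by exists (i1, u i1 i2); left; rewrite !inE eqxx !orbT.
Qed.

Definition triangle_coloring (x : 'I_3 -> G) (j : 'I_3) : R -> G * G :=
  two_steps (first_point j) (second_point j) (triangle_colors x j).

Let marks : [/\ mark E (k i0) (u i0 i1) = (if M is Under then Over else Virtual),
  mark E (k i0) (u i0 i2) = (if M is Under then Over else Virtual) &
  mark E (k i1) (u i1 i2) = (if M' is Under then Over else Virtual)].
Proof.
have d1 : double (curve E) (k i1, u i1 i0) (k i0, u i0 i1).
  by apply: triangle_double; rewrite n10.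
have d2 : double (curve E) (k i2, u i2 i0) (k i0, u i0 i2).
  by apply: triangle_double; rewrite n20.
have d3 : double (curve E) (k i2, u i2 i1) (k i1, u i1 i2).
  by apply: triangle_double; rewrite n21.
split.
- by have := mark_double d1; rewrite /= mark10; case: MM => -> [] [].
- by have := mark_double d2; rewrite /= mark20; case: MM => -> [] [].
- by have := mark_double d3; rewrite /= mark21; case: MM' => -> [] [].
Qed.

Lemma triangle_at0 x : triangle_coloring x i0 (u i0 i1) =
  (triangle_colors x i0 false (u i0 i2 < u i0 i1),
   triangle_colors x i0 true (u i0 i2 < u i0 i1)).
Proof.
rewrite /triangle_coloring /first_point /second_point eqxx two_steps_fst //.
by apply: triangle_neq; rewrite ?n01 ?n02 ?n12.
Qed.

Lemma triangle_at0' x : triangle_coloring x i0 (u i0 i2) =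
  (triangle_colors x i0 (u i0 i1 < u i0 i2) false,
   triangle_colors x i0 (u i0 i1 < u i0 i2) true).
Proof.
rewrite /triangle_coloring /first_point /second_point eqxx two_steps_snd //.
by apply: triangle_neq; rewrite ?n01 ?n02 ?n12.
Qed.

Lemma triangle_at1 x : triangle_coloring x i1 (u i1 i0) =
  (triangle_colors x i1 false (u i1 i2 < u i1 i0),
   triangle_colors x i1 true (u i1 i2 < u i1 i0)).
Proof.
rewrite /triangle_coloring /first_point /second_point n10 eqxx two_steps_fst //.
by apply: triangle_neq; rewrite ?n10 ?n02 ?n12.
Qed.

Lemma triangle_at1' x : triangle_coloring x i1 (u i1 i2) =
  (triangle_colors x i1 (u i1 i0 < u i1 i2) false,
   triangle_colors x i1 (u i1 i0 < u i1 i2) true).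
Proof.
rewrite /triangle_coloring /first_point /second_point n10 eqxx two_steps_snd //.
by apply: triangle_neq; rewrite ?n10 ?n02 ?n12.
Qed.

Lemma triangle_at2 x : triangle_coloring x i2 (u i2 i0) =
  (triangle_colors x i2 false (u i2 i1 < u i2 i0),
   triangle_colors x i2 true (u i2 i1 < u i2 i0)).
Proof.
rewrite /triangle_coloring /first_point /second_point n20 n21 two_steps_fst //.
by apply: triangle_neq; rewrite ?n20 ?n21 ?n01.
Qed.

Lemma triangle_at2' x : triangle_coloring x i2 (u i2 i1) =
  (triangle_colors x i2 (u i2 i0 < u i2 i1) false,
   triangle_colors x i2 (u i2 i0 < u i2 i1) true).
Proof.
rewrite /triangle_coloring /first_point /second_point n20 n21 two_steps_snd //.
by apply: triangle_neq; rewrite ?n20 ?n21 ?n01.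
Qed.

Lemma triangle_rules x d e : (d, e) \in triangle_pairs ->
  rule_at op f k E (triangle_coloring x) d e /\
  rule_at op f k E (triangle_coloring x) e d.
Proof.
have [m01 m02 m12] := marks.
have s10 : from_right E (k i0, u i0 i1) (k i1, u i1 i0) = ~~ s01.
  by rewrite -s01E from_rightN //; apply: triangle_double; rewrite n10.
have s20 : from_right E (k i0, u i0 i2) (k i2, u i2 i0) = ~~ s02.
  by rewrite -s02E from_rightN //; apply: triangle_double; rewrite n20.
have s21 : from_right E (k i1, u i1 i2) (k i2, u i2 i1) = ~~ s12.
  by rewrite -s12E from_rightN //; apply: triangle_double; rewrite n21.
have ruleE C j y l z : (C j y).2 = passed op f (mark E (k j) y)
    (from_right E (k j, y) (k l, z)) (C j y).1 (C l z).2 ->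
  rule_at op f k E C (j, y) (l, z) by [].
rewrite !inE => /or3P[] /eqP[-> ->]; split; apply: ruleE.
- rewrite triangle_at0 triangle_at1 mark10 s01E /triangle_colors !eqxx n10.
  by rewrite /cross_top /toggled; case: MM => -> /=.
- rewrite triangle_at0 triangle_at1 m01 s10 /triangle_colors !eqxx n10.
  by rewrite /toggled; case: MM => -> /=.
- rewrite triangle_at0' triangle_at2 mark20 s02E /triangle_colors !eqxx n20 n21.
  by rewrite /cross_top /toggled; case: MM => -> /=.
- rewrite triangle_at0' triangle_at2 m02 s20 /triangle_colors !eqxx n20 n21.
  rewrite /toggled; case: MM => -> //=; case: (_ < _) => //; exact: vactC.
(* At the crossing of [i2] with [i1], the passage of [i0] is pushed through the rule by
   [cross_top_passed], and [middle_colorE] then gives the color of [i1]. *)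
- rewrite triangle_at1' triangle_at2' mark21 s12E side.
  rewrite /triangle_colors n10 !eqxx n20 n21.
  rewrite ![(_, _).1]/= ![(_, _).2]/=.
  have -> : forall c y z, toggled (cross_top x) s02 c (passed op f M' s12 y z) =
      passed op f M' s12 (toggled (cross_top x) s02 c y)
                         (toggled (cross_top x) s02 c z).
    by move=> [] y z //=; apply: cross_top_passed.
  by rewrite middle_colorE; case: MM' => ->.
rewrite triangle_at1' triangle_at2' m12 s21 /triangle_colors n10 !eqxx.
case: MM' => mE'; rewrite mE' //=.
have mE : M = Virtual by case: MM => // /M_under; rewrite mE'.
rewrite /cross_top mE /= /toggled; case: (_ < _) => //.
exact: vactC.
Qed.

Lemma triangle_solution :
  local_solution op f k a b E (fun x j => triangle_colors x j true true)
    triangle_coloring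
    [seq de <- triangle_pairs | is_under (mark E (k de.1.1) de.1.2)].
Proof.
have cpP := triangle_crossing_pairs.
pose rank (j : 'I_3) := if j == i0 then 0%N else if j == i1 then 1%N else 2%N.
apply: (@two_steps_solution _ _ op _ _ f _ _ _ _ E_strands _ rank
  first_point second_point triangle_colors cpP triangle_pairs_uniq).
- move=> d e; rewrite !inE => /or3P[] /eqP[-> ->] _;
  by rewrite /rank /= ?eqxx ?n10 ?n20 ?n21 ?eqxx.
- have [m01 m02 m12] := marks.
  have MS : M <> Simple by case: MM => ->.
  have MS' : M' <> Simple by case: MM' => ->.
  have CS (N : passage) : (if N is Under then Over else Virtual) <> Simple.
    by case: N.
  move=> j; rewrite /first_point /second_point.
  have [->|->|->] := I3P j; rewrite ?eqxx ?n10 ?n20 ?n21 ?eqxx;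
    split; rewrite ?m01 ?m02 ?m12 ?mark10 ?mark20 ?mark21 //;
    rewrite ?triangle_inside ?triangle_neq ?n01 ?n02 ?n12 ?n10 ?n20 ?n21 //.
- move=> x j; rewrite /triangle_colors /toggled.
  have [->|->|->] := I3P j; rewrite ?eqxx ?n10 ?n20 ?n21 ?eqxx //.
    by case: M.
  by case: M'.
exact: triangle_rules.
Qed.

(** Only the crossing of [i1] and [i2] is classical; both colors there carry [f] or its inverse
    exactly when [i2] has already passed [i0]. *)
Lemma triangle_weight_mixed x : M = Virtual -> M' = Under ->
  local_weight op k phi E triangle_coloring
    [seq de <- triangle_pairs | is_under (mark E (k de.1.1) de.1.2)] x =
  wt op phi s12 (toggled (vact f) s02 (u i2 i0 < u i2 i1) (x i2))
    (toggled (vact f) s02 (u i2 i0 < u i2 i1) (middle_color x)).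
Proof.
move=> mE mE'; have topE : cross_top x = vact f by rewrite /cross_top mE.
rewrite /triangle_pairs /= mark10 mark20 mark21 mE mE' /= /local_weight big_seq1.
rewrite s12E triangle_at1' triangle_at2' /triangle_colors n10 !eqxx n20 n21 mE'.
by rewrite -topE middle_colorE side.
Qed.

Lemma triangle_weight_virtual x : M = Virtual -> M' = Virtual ->
  local_weight op k phi E triangle_coloring
    [seq de <- triangle_pairs | is_under (mark E (k de.1.1) de.1.2)] x = uone K.
Proof.
move=> mE mE'; rewrite /triangle_pairs /= mark10 mark20 mark21 mE mE' /=.
by rewrite /local_weight big_nil.
Qed.

Hypothesis phi_cocycle : cocycle op phi.

(** The right side is the weight when [i2] meets [i1] before [i0], and the cocycle identity converts
    the other order. It does not involve [u], so it serves both diagrams of the move. *)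
Lemma triangle_weight_classical x : M = Under ->
  local_weight op k phi E triangle_coloring
    [seq de <- triangle_pairs | is_under (mark E (k de.1.1) de.1.2)] x =
  umul (wt op phi s01 (x i1) (x i0))
    (umul (wt op phi s12 (x i2) (middle_color x))
          (wt op phi s02 (act op s12 (x i2) (middle_color x)) (x i0))).
Proof.
move=> mE; have mE' := M_under mE.
have topE e y : cross_top x e y = act op e y (x i0) by rewrite /cross_top mE.
rewrite /triangle_pairs /= mark10 mark20 mark21 mE mE' /= /local_weight.
rewrite !big_cons big_nil umulu1 s01E s02E s12E triangle_at0 triangle_at0'.
rewrite triangle_at1 triangle_at1' triangle_at2 triangle_at2'.
rewrite /triangle_colors n10 !eqxx n20 n21 mE mE' side -middle_colorE.
congr umul; have u21 : u i2 i0 != u i2 i1.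
  by apply: triangle_neq; rewrite ?n20 ?n21 ?n01.
rewrite /toggled /=; have [lt_u|gt_u|eq_u] := ltgtP (u i2 i0) (u i2 i1).
- by rewrite !topE [RHS](wt_cocycle Gquandle phi_cocycle).
- exact: umulC.
by rewrite eq_u eqxx in u21.
Qed.

End Triangle.

(** * The third moves: geometry of the triangle and invariance *)

Section Move3.
Variables (R : realType).

Lemma derive1_affine (V : normedModType R) (P v : V) (y : R) :
  derive1 (fun x : R => P + x *: v) y = v.
Proof.
rewrite /derive1; apply/cvg_lim => //; apply: cvg_near_cst; near=> h.
have h0 : h != 0 by near: h; exact: nbhs_dnbhs_neq.
have -> : P + (h + y) *: v - (P + y *: v) = h *: v.
  by rewrite scalerDl opprD addrACA subrr add0r addrK.
by rewrite scalerA mulVf // scale1r.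
Unshelve. all: by end_near. Qed.

Lemma velocity_affine n (D : diagram R n) i (a b y : R) (P v : plane R) :
  a < y < b -> (forall x, a <= x <= b -> curve D i x = P + x *: v) ->
  velocity D (i, y) = v.
Proof.
move=> yab Dlin; rewrite /velocity /= -[RHS](derive1_affine P v y) !derive1E.
apply: near_eq_derive; apply/near_eps; exists (Num.min (y - a) (b - y)).
  by rewrite lt_min; lra.
have : Num.min (y - a) (b - y) <= y - a by rewrite ge_min lexx.
have : Num.min (y - a) (b - y) <= b - y by rewrite ge_min lexx orbT.
by move=> H1 H2 x xy; apply: Dlin; lra.
Qed.

Lemma pos_mul (x y : R) : x != 0 -> y != 0 -> (0 < x * y) = ((0 < x) == (0 < y)).
Proof.
move=> x0 y0; have [xp|xn|xE] := ltgtP 0 x; last by rewrite -xE eqxx in x0.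
  by rewrite pmulr_rgt0 //; case: (0 < y).
rewrite nmulr_rgt0 //; have [yp|yn|yE] := ltgtP 0 y => //.
by rewrite -yE eqxx in y0.
Qed.

Lemma segments_side (P0 P1 P2 V0 V1 V2 : plane R) (x01 x02 x10 x12 x20 x21 : R) :
  P0 + x01 *: V0 = P1 + x10 *: V1 -> P0 + x02 *: V0 = P2 + x20 *: V2 ->
  P1 + x12 *: V1 = P2 + x21 *: V2 ->
  x10 != x12 -> x20 != x21 -> cross V0 V1 != 0 -> cross V0 V2 != 0 ->
  (x10 < x12) = ((x20 < x21) == ((0 < cross V0 V1) == (0 < cross V0 V2))).
Proof.
move=> e01 e02 e12 n1 n2 c1 c2.
have key : (x12 - x10) * cross V0 V1 = (x21 - x20) * cross V0 V2.
  have coord (p : plane R -> R) : (forall u v, p (u + v) = p u + p v) ->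
      (forall c u, p (c *: u) = c * p u) ->
      (x12 - x10) * p V1 = p P2 + x21 * p V2 - (p P0 + x01 * p V0) /\
      (x21 - x20) * p V2 = p P2 + x21 * p V2 - (p P0 + x02 * p V0).
    move=> pD pZ; have := congr1 p e01; have := congr1 p e02.
    have := congr1 p e12; rewrite !pD !pZ => E12 E02 E01.
    by rewrite !mulrBl -E12; split; lra.
  have [X1 X2] := coord fst (fun _ _ => erefl) (fun _ _ => erefl).
  have [Y1 Y2] := coord snd (fun _ _ => erefl) (fun _ _ => erefl).
  have H (u v : plane R) (c : R) :
      c * cross u v = u.1 * (c * v.2) - u.2 * (c * v.1).
    by rewrite /cross; ring.
  by rewrite !H X1 X2 Y1 Y2; ring.
have d1 : x12 - x10 != 0 by rewrite subr_eq0 eq_sym.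
have d2 : x21 - x20 != 0 by rewrite subr_eq0 eq_sym.
have := pos_mul d1 c1; rewrite key (pos_mul d2 c2) !subr_gt0.
by case: (_ < _) (_ < _) (_ < _) (_ < _) => [] [] [] [].
Qed.

Variables (G : finType) (op : G -> G -> G) (n : nat).
Hypothesis Gquandle : quandle op.
Variables (K : comUnitRingType) (phi : G -> G -> units K).
Hypothesis phi_cocycle : cocycle op phi.
Variable f : {perm G}.
Hypothesis f_aut : quandle_aut op f.

Lemma move3_related (D D' : diagram R n) : move3 D D' ->
  exists rel v, related_by op phi phi D D' f rel v.
Proof.
move=> [k [a [b [u [u' [[DD' tD tD'] [P [V segm]] types moved order]]]]]].
have [D_strands D'_strands _] := DD'.
have n01 : ((0 : 'I_3) == 1) = false by [].
have n02 : ((0 : 'I_3) == 2) = false by [].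
have n12 : ((1 : 'I_3) == 2) = false by [].
have n10 : ((1 : 'I_3) == 0) = false by [].
have n20 : ((2 : 'I_3) == 0) = false by [].
have n21 : ((2 : 'I_3) == 1) = false by [].
move: n01 n02 n12 n10 n20 n21 types moved order.
(* Only the distinctness of the three indices is kept. *)
move: (0 : 'I_3) (1 : 'I_3) (2 : 'I_3) => i0 i1 i2.
move=> n01 n02 n12 n10 n20 n21 types moved order.
have dD := triangle_double D_strands tD; have nD := triangle_neq D_strands tD.
have d10 : double (curve D) (k i1, u i1 i0) (k i0, u i0 i1) by apply: dD; rewrite n10.
have d20 : double (curve D) (k i2, u i2 i0) (k i0, u i0 i2) by apply: dD; rewrite n20.
have d21 : double (curve D) (k i2, u i2 i1) (k i1, u i1 i2) by apply: dD; rewrite n21.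
have u1 : u i1 i0 != u i1 i2 by apply: nD; rewrite ?n10 ?n12 ?n02.
have u2 : u i2 i0 != u i2 i1 by apply: nD; rewrite ?n20 ?n21 ?n01.
have [M [M' [MM MM' M_under]]] : exists M M', [/\ M = Under \/ M = Virtual,
    M' = Under \/ M' = Virtual, M = Under -> M' = Under &
    [/\ mark D (k i1) (u i1 i0) = M, mark D (k i2) (u i2 i0) = M &
        mark D (k i2) (u i2 i1) = M']].
  have := mark_double d10; have := mark_double d20; have := mark_double d21.
  rewrite /=; case: types => -[-> -> ->] [] [-> //] _ [] [-> //] _ [] [-> //] _.
  - by exists Under, Under; split=> //; left.
  - by exists Virtual, Virtual; split=> //; right.
  - by exists Virtual, Under; split=> //; [right|left].
move=> [m10 m20 m21].
have [m10' s10'] := moved i1 i0 (negbT n10).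
have [m20' s20'] := moved i2 i0 (negbT n20).
have [m21' s21'] := moved i2 i1 (negbT n21).
rewrite m10 in m10'; rewrite m20 in m20'; rewrite m21 in m21'.
have [s01 s01E] : exists s, from_right D (k i1, u i1 i0) (k i0, u i0 i1) = s.
  by eexists.
have [s02 s02E] : exists s, from_right D (k i2, u i2 i0) (k i0, u i0 i2) = s.
  by eexists.
have [s12 s12E] : exists s, from_right D (k i2, u i2 i1) (k i1, u i1 i2) = s.
  by eexists.
rewrite s01E in s10'; rewrite s02E in s20'; rewrite s12E in s21'.
have vel j l : j != l -> velocity D (k j, u j l) = V j.
  move=> jl; apply: (velocity_affine (P := P j) (triangle_inside tD jl)) => x.
  exact: segm.
have side : (u i1 i0 < u i1 i2) = ((u i2 i0 < u i2 i1) == (s01 == s02)).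
  have on j l : j != l -> curve D (k j) (u j l) = P j + u j l *: V j.
    by move=> jl; apply: segm; have /andP[? ?] := triangle_inside tD jl; rewrite !ltW.
  have meet j l : j != l -> P j + u j l *: V j = P l + u l j *: V l.
    move=> jl; rewrite -!on // 1?eq_sym //; by have [/(_ j l jl)[]] := tD.
  have crossE j l : j != l -> double (curve D) (k l, u l j) (k j, u j l) ->
      cross (V j) (V l) != 0 /\
      from_right D (k l, u l j) (k j, u j l) = (0 < cross (V j) (V l)).
    move=> jl d; have lj : l != j by rewrite eq_sym.
    rewrite /from_right !vel //; split=> //.
    rewrite -(vel _ _ jl) -(vel _ _ lj); exact: (double_transversal (double_sym d)).
  have [c1 s1] := crossE i0 i1 (negbT n01) d10.
  have [c2 s2] := crossE i0 i2 (negbT n02) d20.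
  rewrite -s01E -s02E s1 s2.
  exact: (segments_side (meet i0 i1 (negbT n01)) (meet i0 i2 (negbT n02))
    (meet i1 i2 (negbT n12)) u1 u2 c1 c2).
(* Reversing the orders on [i1] and [i2] negates both comparisons, which preserves the relation. *)
have side' : (u' i1 i0 < u' i1 i2) = ((u' i2 i0 < u' i2 i1) == (s01 == s02)).
  rewrite -(order i1 i2 i0) ?n12 ?n10 ?n20 //.
  rewrite -(order i2 i1 i0) ?n21 ?n20 ?n10 //.
  have e1 : (u i1 i2 < u i1 i0) = ~~ (u i1 i0 < u i1 i2).
    by rewrite -leNgt le_eqVlt eq_sym (negbTE u1).
  have e2 : (u i2 i1 < u i2 i0) = ~~ (u i2 i0 < u i2 i1).
    by rewrite -leNgt le_eqVlt eq_sym (negbTE u2).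
  by rewrite e1 e2 side; case: (u i2 i0 < u i2 i1); case: (s01 == s02).
have sol E v E_strands tE me1 me2 me3 se1 se2 se3 sidee :=
  @triangle_solution R G op n Gquandle f f_aut i0 i1 i2 n01 n02 n12 M M' s01 s02
    s12 MM MM' M_under k a b E v E_strands tE me1 me2 me3 se1 se2 se3 sidee.
have solD := sol D u D_strands tD m10 m20 m21 s01E s02E s12E side.
have solD' := sol D' u' D'_strands tD' m10' m20' m21' s10' s20' s21' side'.
pose LW (E : diagram R n) v := local_weight op k phi E
  (triangle_coloring op f i0 i1 i2 M M' s01 s02 s12 v)
  [seq de <- triangle_pairs i0 i1 i2 v | is_under (mark E (k de.1.1) de.1.2)].
suff [v vP] : exists v, forall x,
    umul (LW D' u' x) (v x) = umul (LW D u x) (v (f \o x)).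
  exists (agree_off_strands k a b), (fun A => v (inputs k a A)).
  exact: (local_related_by Gquandle DD' solD solD').
case: (MM) => mE.
  exists (fun=> uone K) => x; rewrite !umulu1 /LW.
  rewrite (triangle_weight_classical Gquandle f n01 n02 n12 MM M_under
    D_strands tD m10 m20 m21 s01E s02E s12E side phi_cocycle x mE).
  exact: (triangle_weight_classical Gquandle f n01 n02 n12 MM M_under
    D'_strands tD' m10' m20' m21' s10' s20' s21' side' phi_cocycle x mE).
case: (MM') => mE'; last first.
  exists (fun=> uone K) => x; rewrite !umulu1 /LW.
  rewrite (triangle_weight_virtual op phi f s01 s02 s12 m10 m20 m21 x mE mE').
  exact: (triangle_weight_virtual op phi f s01 s02 s12 m10' m20' m21' x mE mE').
(* In the mixed move, [g] is the weight of the classical crossing on the side of [i0] where [i2]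
   enters and [g'] its weight on the other side; the move exchanges them. *)
pose Y x := middle_color op f i0 i1 M s01 s02 x.
pose g x := wt op phi s12 (x i2) (Y x).
pose g' x := wt op phi s12 (vact f s02 (x i2)) (vact f s02 (Y x)).
have wE (v : 'I_3 -> 'I_3 -> R) (bb : bool) x : (v i2 i0 < v i2 i1) = bb ->
    wt op phi s12 (toggled (vact f) s02 (v i2 i0 < v i2 i1) (x i2))
      (toggled (vact f) s02 (v i2 i0 < v i2 i1) (Y x)) = if bb then g' x else g x.
  by move=> ->; case: bb.
have lwD x : LW D u x = if u i2 i0 < u i2 i1 then g' x else g x.
  rewrite /LW (triangle_weight_mixed Gquandle phi f n01 n02 n12 MM
    D_strands tD m10 m20 m21 s12E side x mE mE').
  exact: (wE u _ x erefl).
have lwD' x : LW D' u' x = if u i2 i0 < u i2 i1 then g x else g' x.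
  rewrite /LW (triangle_weight_mixed Gquandle phi f n01 n02 n12 MM
    D'_strands tD' m10' m20' m21' s21' side' x mE mE').
  rewrite -[RHS]if_neg; apply: (wE u').
  rewrite -(order i2 i1 i0) ?n21 ?n20 ?n10 //.
  by rewrite -leNgt le_eqVlt eq_sym (negbTE u2).
have Yf x : Y (f \o x) = f (Y x).
  rewrite /Y /middle_color /cross_top mE /=; case: (_ == _) => //.
  exact: (vactC f _ false).
(* Passing [i0] applies [f^-1] if [s02] holds and [f] otherwise, so one of the two weights is the
   other composed with [f]. *)
have ggf x : if s02 then g' (f \o x) = g x else g' x = g (f \o x).
  rewrite /g /g' Yf; case: (s02) => //=.
  by rewrite /vact !permK.
clearbody g g' LW.
(* If [LW D'] is [LW D] composed with [f], then [v] is [LW D]; in the opposite situation [v] is the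
   inverse of [LW D']. The tests on [s02] and on the order along [i2] select the case. *)
have [s2|s2] := boolP s02.
  rewrite s2 in ggf.
  exists (fun x => if u i2 i0 < u i2 i1 then g' x else uinv (g' x)) => x.
  rewrite lwD lwD' ggf; case: ifP => _; first exact: umulC.
  by rewrite umuluV umuluV.
rewrite (negbTE s2) in ggf.
exists (fun x => if u i2 i0 < u i2 i1 then uinv (g x) else g x) => x.
rewrite lwD lwD' ggf; case: ifP => _; last exact: umulC.
by rewrite umuluV umuluV.
Qed.

End Move3.

(** * Passage to the generated equivalence relation, and conclusion *)

Lemma same_link_eq (R : realType) (n : nat) (T : Type) (F : diagram R n -> T) :
  (forall D D', [\/ planar_isotopic D D', move1 D D', move2 D D' | move3 D D'] ->
    F D = F D') ->
  forall D D', same_link D D' -> F D = F D'.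
Proof.
move=> H D D'; elim=> {D D'} [D D' /H //|//|D D' _ -> //|D D1 D' _ -> _ -> //].
Qed.

Lemma same_link_invariant (R : realType) (G : finType) (op : G -> G -> G)
    (K : comUnitRingType) (phi : G -> G -> units K) (n : nat)
    (D D' : diagram R n) (f : {perm G}) :
  quandle op -> cocycle op phi -> quandle_aut op f -> same_link D D' ->
  \uprod_(A \in colorings op D f) weight phi D A =
    \uprod_(A \in colorings op D' f) weight phi D' A /\
  Z4 op phi D f = Z4 op phi D' f.
Proof.
move=> Gquandle phi_cocycle f_aut DD'.
(* Pairing the product over all colorings with [Z4] lets one induction on the moves treat both. *)
pose F (D0 : diagram R n) :=
  (\uprod_(A \in colorings op D0 f) weight phi D0 A, Z4 op phi D0 f).
suff /pair_equal_spec : F D = F D' by [].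
apply: same_link_eq DD' => {}D {}D' moveDD'.
have [rel [v DD']] : exists rel v, related_by op phi phi D D' f rel v.
  case: moveDD' => [[H [sigma [r [H_iso r_rep curveE markE]]]]|mv|mv|mv].
  - exists (moved_colors sigma r), (fun=> uone K).
    exact: (moved_related_by op f phi H_iso r_rep curveE markE).
  - exact: move1_related mv.
  - exact: move2_related mv.
  - exact: move3_related mv.
have [e1 e2] := related_transfer Gquandle f_aut DD'.
exact: (f_equal2 pair (esym e1) (esym e2)).
Qed.

Theorem theorem2p5 (R : realType) (G : finType) (op : G -> G -> G)
    (K : comUnitRingType) (phi : G -> G -> units K)
    (Gquandle : quandle op) (phi_cocycle : cocycle op phi) :
  [/\ forall (n : nat) (D D' : diagram R n), same_link D D' ->
        Z3 op phi D = Z3 op phi D',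
      forall (f : {perm G}), quandle_aut op f ->
      forall (n : nat) (D D' : diagram R n), same_link D D' ->
        Z4 op phi D f = Z4 op phi D' f
    & forall (phi' : G -> G -> units K), cocycle op phi' ->
      cohomologous op phi phi' ->
      forall (n : nat) (D : diagram R n) (f : {perm G}), quandle_aut op f ->
        Z4 op phi D f = Z4 op phi' D f].
Proof.
split=> [n D D' DD'|f f_aut n D D' DD'|phi' phi'_cocycle cohom n D f f_aut].
- apply: eq_bigr => f f_aut.
  have [e _] := same_link_invariant Gquandle phi_cocycle f_aut DD'.
  exact: (congr1 (@formal_power K) e).
- exact: (proj2 (same_link_invariant Gquandle phi_cocycle f_aut DD')).
have [delta [_ [psi deltaE] phiE]] := cohom.
have phiE' x y : phi x y = umul (umul (psi x) (uinv (psi (op x y)))) (phi' x y).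
  by rewrite phiE deltaE.
(* The diagram stays fixed: the colorings correspond by the identity and only the weights change. *)
have cohom_related := cohomologous_related_by Gquandle f D phiE'.
exact/esym/(proj2 (related_transfer Gquandle f_aut cohom_related)).
Qed.
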